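(* For each admissible triple $(p_0,q_0,r_0)$: (a) there exists a nondoubling metric measure space $\mathfrak Z$ such that $\mathfrak c(p_0,q_0,r,\mathfrak Z)=\infty$ for $r\in[q_0,r_0]$ and $\mathfrak c(p_0,q_0,r,\mathfrak Z)<\infty$ for $r\in(r_0,\infty]$; (b) there exists a nondoubling metric measure space $\mathfrak Z'$ such that $\mathfrak c(p_0,q_0,r,\mathfrak Z')=\infty$ for $r\in[q_0,r_0)$ and $\mathfrak c(p_0,q_0,r,\mathfrak Z')<\infty$ for $r\in[r_0,\infty]$.
   Context: Metric measure space $(X,\rho,\mu)$: nonempty set, metric, nonnegative Borel measure, every open ball of positive finite measure; doubling means $\mu(B(x,2s))\le C\mu(B(x,s))$ uniformly. Lorentz quasinorm: $d_f(t)=\mu(\{|f|>t\})$, $\|f\|_{p,q}=p^{1/q}(\int_0^\infty(t d_f(t)^{1/p})^q dt/t)^{1/q}$ for $q<\infty$, $\|f\|_{p,\infty}=\sup_{t>0}t d_f(t)^{1/p}$. $\mathcal M^{\rm c}_{\mathfrak X}f(x)=\sup_{s>0}\mu(B(x,s))^{-1}\int_{B(x,s)}|f|d\mu$. $\mathfrak c(p,q,r,\mathfrak X)$ is the smallest $c$ with $\|\mathcal M^{\rm c}_{\mathfrak X}f\|_{p,r}\le c\|f\|_{p,q}$ for all $f\in L^{p,q}(\mathfrak X)$ ($\infty$ if none). A triple $(p,q,r)$ is admissible if either $p=q=1$ and $r\in[1,\infty]$, or $p\in(1,\infty)$ and $q,r\in[1,\infty]$ with $q\le r$. *)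

(* Defs.v *)
From HB Require Import structures.
From mathcomp Require Import all_boot all_order all_algebra.
From mathcomp Require Import all_classical all_reals all_analysis.
Set Implicit Arguments. Unset Strict Implicit. Unset Printing Implicit Defensive.
Import Order.TTheory GRing.Theory Num.Theory.
Local Open Scope classical_set_scope.
Local Open Scope ring_scope.

Section MMS.
Context {R : realType} {d : measure_display} {T : measurableType d}.
Variables (rho : T -> T -> R) (mu : {measure set T -> \bar R}).

Definition oball (x : T) (s : R) : set T := [set y | rho x y < s].

Definition is_metric : Prop :=
  (forall x y, 0 <= rho x y) /\ (forall x y, rho x y = 0 <-> x = y) /\
  (forall x y, rho x y = rho y x) /\
  (forall x y z, rho x z <= rho x y + rho y z).

Definition rho_open (U : set T) : Prop :=
  forall x, U x -> exists2 e : R, 0 < e & oball x e `<=` U.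

Definition metric_measure_space : Prop :=
  (exists x : T, True) /\ is_metric /\
  (@measurable d T = <<s rho_open >>) /\
  (forall x s, 0 < s -> (0 < mu (oball x s))%E /\ (mu (oball x s) < +oo)%E).

Definition doubling : Prop :=
  exists C : R, forall x s, 0 < s ->
    (mu (oball x (2 * s)) <= C%:E * mu (oball x s))%E.

Definition distrib (g : T -> \bar R) (t : R) : \bar R :=
  mu [set x | (t%:E < `|g x|)%E].

Definition lorentz (p : R) (q : \bar R) (g : T -> \bar R) : \bar R :=
  match q with
  | +oo%E => ereal_sup [set (t%:E * poweR (distrib g t) (p^-1)%R)%E | t in [set t : R | (0 < t)%R]]
  | q'%:E => (((p `^ q'^-1)%R)%:E *
      poweR (\int[@lebesgue_measure R]_(t in [set t : R | (0 < t)%R])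
               (poweR (t%:E * poweR (distrib g t) (p^-1)%R) q' * ((t^-1)%R)%:E))
            (q'^-1)%R)%E
  | -oo%E => 0%E
  end.

Definition cmaximal (f : T -> R) (x : T) : \bar R :=
  ereal_sup [set ((\int[mu]_(y in oball x s) `|f y|%:E) *
                  ((fine (mu (oball x s)))^-1)%R%:E)%E | s in [set s : R | (0 < s)%R]].

Definition cmax_const (p : R) (q r : \bar R) : \bar R :=
  ereal_inf [set c%:E | c in [set c : R | 0 <= c /\
     forall f : T -> R, measurable_fun setT f ->
       (lorentz p q (fun x => (f x)%:E) < +oo)%E ->
       (lorentz p r (cmaximal f) <= c%:E * lorentz p q (fun x => (f x)%:E))%E]].

End MMS.

Definition admissible {R : realType} (p : R) (q r : \bar R) : Prop :=
  (p = 1 /\ q = 1%E /\ (1 <= r)%E) \/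
  (1 < p /\ (1 <= q)%E /\ (q <= r)%E).

(* Main.v *)
(** Idea. The space has a centre [o] and, for every stage [k], [N k] pairs
    [(x, y)] of atoms with masses [m k <= D k], where [D] grows very fast.  The
    metric is such that a ball about [x] is [{x}], or [{o, x, y}], or it
    contains all the [y]'s of some stage [K > k] and nothing beyond stage [K];
    a ball about [y] is [{y}] or of the last kind.  Balls of the last kind
    outweigh the stage of their centre so much that averages over them are
    bounded by [||f||] times a function lying in every [L^{p,r}], while the
    average over [{o, x, y}] is at most [max(|f x|, |f y|) + |f o| / D k].  As
    [y] outweighs [x], copying values from [y] to [x] does not increase the
    distribution function, so that only the rank one operator
    [f |-> |f o| w], with [w = 1 / D k] on the [x]'s of stage [k], matters.
    The choice [N k * m k = (b k * D k) ^ p] makes [w] belong to [L^{p,r}] if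
    and only if [b] belongs to [l^r], and it remains to choose [b]. *)
Require Import Defs.
From HB Require Import structures.
From mathcomp Require Import all_boot all_order all_algebra.
From mathcomp Require Import all_classical all_reals all_analysis.
From mathcomp Require Import measurable_realfun zify ring lra.
Import Order.TTheory GRing.Theory Num.Theory.
Import numFieldNormedType.Exports.
Local Open Scope classical_set_scope.
Local Open Scope ring_scope.

(** * Lorentz quasinorms of distribution functions *)

(** The centre has mass 1, so [|f o|] is bounded by the weak quasinorm, hence by a multiple of
    [||f||_{p,q}] for every [q]. This is why the threshold is governed by [r] alone: [q] enters only
    through the embedding of [L^{p,q}] into [L^{p,r}], which controls the part of [f] that is
    copied. Conversely the indicator of the centre is mapped above a multiple of [w]. The balls of
    the last kind must be harmless for every [r], and a mere weak type bound would not achieve this.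
    Their averages therefore have to decay summably against the mass of the stages, which is what
    the factor [2 ^+ k] and the square in [growth_fast] pay for. A Lorentz quasinorm has no triangle
    inequality with constant 1, so the maximal function is not split into a sum of functions. Its
    level set at [t] is covered by level sets at [t/2] and [t/4], and the quasinorm is treated as a
    functional of nonincreasing functions [d]. *)

Definition lint {R : realType} (p q : R) (d : R -> \bar R) : \bar R :=
  (\int[@lebesgue_measure R]_(t in [set t : R | (0 < t)%R])
     (poweR (t%:E * poweR (d t) (p^-1)%R) q * ((t^-1)%R)%:E))%E.

Definition lor {R : realType} (p : R) (q : \bar R) (d : R -> \bar R) : \bar R :=
  match q with
  | +oo%E => ereal_sup
      [set (t%:E * poweR (d t) (p^-1)%R)%E | t in [set t : R | (0 < t)%R]]
  | q'%:E => (((p `^ q'^-1)%R)%:E * poweR (lint p q' d) (q'^-1)%R)%E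
  | -oo%E => 0%E
  end.

Lemma lorentzE {R : realType} {dT : measure_display} {T : measurableType dT}
  (mu : {measure set T -> \bar R}) p q g :
  lorentz mu p q g = lor p q (distrib mu g).
Proof. by case: q. Qed.

Definition dist_fun {R : realType} (d : R -> \bar R) : Prop :=
  (forall t, (0 <= d t)%E) /\ (forall s t, s <= t -> (d t <= d s)%E).

Section distribution_functions.
Context {R : realType}.
Implicit Types (p q r s t M : R) (d : R -> \bar R).
Local Notation D0 := [set t : R | 0 < t].

Lemma measurable_pos : measurable D0.
Proof.
rewrite (_ : D0 = `]0, +oo[%classic) //.
by apply/seteqP; split => x /=; rewrite in_itv/= andbT.
Qed.

Lemma dist_fun_measurable d : dist_fun d -> measurable_fun [set: R] d.
Proof.
move=> [_ dn]; apply: (measurability _ (ErealGenOInfty.measurableE R)).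
move=> /= _ [_ [x ->] <-]; rewrite setTI.
apply: is_interval_measurable => a b /=; rewrite !in_itv/= !andbT.
by move=> xa xb c /andP[ac cb]; rewrite in_itv/= andbT (lt_le_trans xb)// dn.
Qed.

Lemma ge0_le_poweR r (x y : \bar R) : 0 <= r -> (0 <= x)%E -> (x <= y)%E ->
  (poweR x r <= poweR y r)%E.
Proof.
move=> r0 x0 xy; apply: gt0_ler_poweR => //; rewrite in_itv/= leey andbT //.
exact: le_trans xy.
Qed.

Lemma lint_fun_measurable p q d : dist_fun d ->
  measurable_fun D0 (fun t =>
    (poweR (t%:E * poweR (d t) p^-1) q * (t^-1)%:E)%E).
Proof.
move=> dd; apply: emeasurable_funM; last first.
  apply/measurable_EFinP.
  apply: (eq_measurable_fun (fun t : R => t `^ (-1))).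
    by move=> t; rewrite inE /= => t0; rewrite powR_inv1// ltW.
  by apply: measurable_funTS; exact: measurable_powR.
apply: (measurableT_comp (measurable_poweR _)).
apply: emeasurable_funM; first exact: EFin_measurable.
apply: (measurableT_comp (measurable_poweR _)).
by apply: measurable_funTS; exact: dist_fun_measurable.
Qed.

Lemma lint_fun_ge0 q t (x : \bar R) : 0 < t ->
  (0 <= poweR x q * (t^-1)%:E)%E.
Proof. by move=> t0; rewrite mule_ge0 ?poweR_ge0// lee_fin invr_ge0 ltW. Qed.

Lemma lint_ge0 p q d : (0 <= lint p q d)%E.
Proof. by apply: integral_ge0 => t /= t0; exact: lint_fun_ge0. Qed.

(** Taking [q]-th powers removes the outer root, so that finite exponents reduce to linear estimates
    of [lint]. *)
Lemma lor_finP p q d M : 0 < p -> 0 < q -> 0 <= M ->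
  (lor p q%:E d <= M%:E)%E <-> (p%:E * lint p q d <= (M `^ q)%:E)%E.
Proof.
move=> p0 q0 M0 /=.
have I0 := lint_ge0 p q d.
rewrite -poweR_EFin -poweRM//.
  2: by rewrite lee_fin; exact: ltW.
have qi0 : 0 <= q^-1 by rewrite invr_ge0; exact: ltW.
have X0 : (0 <= p%:E * lint p q d)%E by rewrite mule_ge0// lee_fin; exact: ltW.
split=> H.
- have := @ge0_le_poweR q _ _ (ltW q0) (poweR_ge0 _ _) H.
  by rewrite -poweRrM mulVf ?gt_eqF// poweRe1// poweR_EFin.
- have := @ge0_le_poweR q^-1 _ _ qi0 X0 H.
  by rewrite poweR_EFin -powRrM mulfV ?gt_eqF// powRr1.
Qed.

Lemma lor_yP p d (M : \bar R) :
  (lor p +oo d <= M)%E <->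
  (forall t, 0 < t -> (t%:E * poweR (d t) p^-1 <= M)%E).
Proof.
split=> [H t t0|H].
  by apply: le_trans H; apply: ereal_sup_ubound; exists t.
by apply: ge_ereal_sup => _ [t /= t0 <-]; exact: H.
Qed.

Lemma lor_ge0 p (q : \bar R) d : 0 <= p -> (0 <= lor p q d)%E.
Proof.
case: q => [q p0||//].
  by rewrite mule_ge0 ?lee_fin ?powR_ge0// poweR_ge0.
move=> p0.
have H : ((1%R)%:E * poweR (d 1%R) p^-1 <= lor p +oo d)%E.
  by apply: ereal_sup_ubound; exists 1 => //=.
by apply: le_trans H; rewrite mul1e poweR_ge0.
Qed.

Lemma le_lint p q d1 d2 : 0 < p -> 0 <= q -> dist_fun d1 -> dist_fun d2 ->
  (forall t, 0 < t -> (d1 t <= d2 t)%E) -> (lint p q d1 <= lint p q d2)%E.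
Proof.
move=> p0 q0 dd1 dd2 d12; apply: ge0_le_integral.
- exact: measurable_pos.
- by move=> t /= t0; exact: lint_fun_ge0.
- exact: lint_fun_measurable.
- exact: lint_fun_measurable.
- move=> t /= t0; apply: lee_wpmul2r; first by rewrite lee_fin invr_ge0 ltW.
  apply: ge0_le_poweR => //; first by rewrite mule_ge0 ?poweR_ge0// lee_fin ltW.
  apply: lee_wpmul2l; first by rewrite lee_fin ltW.
  by apply: ge0_le_poweR (d12 _ t0); [rewrite invr_ge0 ltW|exact: dd1.1].
Qed.

Lemma le_lor p (q : \bar R) d1 d2 : 0 < p -> (0 < q)%E ->
  dist_fun d1 -> dist_fun d2 ->
  (forall t, 0 < t -> (d1 t <= d2 t)%E) -> (lor p q d1 <= lor p q d2)%E.
Proof.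
move=> p0; case: q => [q q0|_|//] dd1 dd2 d12.
  rewrite lte_fin in q0.
  apply: lee_wpmul2l; first by rewrite lee_fin powR_ge0.
  apply: ge0_le_poweR; [by rewrite invr_ge0; exact: ltW|exact: lint_ge0|].
  by apply: le_lint => //; exact: ltW.
apply/lor_yP => t t0; apply: le_trans (ereal_sup_ubound _); last by exists t.
apply: lee_wpmul2l; first by rewrite lee_fin ltW.
by apply: ge0_le_poweR (d12 _ t0); [rewrite invr_ge0 ltW|exact: dd1.1].
Qed.

Lemma dist_funD d1 d2 : dist_fun d1 -> dist_fun d2 ->
  dist_fun (fun t => (d1 t + d2 t)%E).
Proof.
move=> [d10 d1n] [d20 d2n]; split=> [t|s t st]; first exact: adde_ge0.
by apply: leeD; [exact: d1n|exact: d2n].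
Qed.

Lemma poweRD_le p (x y : \bar R) : 1 <= p -> (0 <= x)%E -> (0 <= y)%E ->
  (poweR (x + y) p^-1 <= 2%:E * maxe (poweR x p^-1) (poweR y p^-1))%E.
Proof.
move=> p1.
have p0 : 0 < p by exact: lt_le_trans p1.
have pV : 0 <= p^-1 by rewrite invr_ge0 ltW.
wlog xy : x y / (x <= y)%E => [H x0 y0|x0 y0].
  case/orP: (le_total x y) => xy; first exact: H.
  by rewrite addeC maxC; exact: H.
apply: (@le_trans _ _ (poweR (2%:E * y) p^-1)).
  apply: ge0_le_poweR => //; first exact: adde_ge0.
  by rewrite -[2%R]/(1 + 1)%R EFinD ge0_muleDl// !mul1e leeD2r.
rewrite poweRM//; apply: lee_pmul; rewrite ?poweR_ge0//.
  rewrite poweR_EFin lee_fin ler1_powR ?invf_le1//; last by rewrite ler1n.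
by rewrite le_max lexx orbT.
Qed.

(** Pointwise, [(d1 + d2)^{1/p}] is at most twice the maximum of the two roots, and the [q]-th power
    of a maximum is at most the sum of the [q]-th powers. The first step costs a factor 2, the
    second another one because [2 <= 2^q]. *)
Lemma lorD p (q : \bar R) d1 d2 M : 1 <= p -> (1 <= q)%E -> 0 <= M ->
  dist_fun d1 -> dist_fun d2 ->
  (lor p q d1 <= M%:E)%E -> (lor p q d2 <= M%:E)%E ->
  (lor p q (fun t => d1 t + d2 t)%E <= (4 * M)%:E)%E.
Proof.
move=> p1 q1 M0 dd1 dd2.
have p0 : 0 < p by exact: lt_le_trans p1.
have pt t : 0 < t -> (t%:E * poweR (d1 t + d2 t) p^-1 <=
    2%:E * maxe (t%:E * poweR (d1 t) p^-1) (t%:E * poweR (d2 t) p^-1))%E.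
  move=> t0; rewrite -maxe_pMr ?lee_fin ?(ltW t0)//.
  rewrite muleCA; apply: lee_wpmul2l; first by rewrite lee_fin ltW.
  by apply: poweRD_le => //; [exact: dd1.1|exact: dd2.1].
case: q q1 => [q q1|_|//].
  rewrite lee_fin in q1.
  have q0 : 0 < q by exact: lt_le_trans q1.
  move=> /(lor_finP _ _ _ _ p0 q0 M0) h1 /(lor_finP _ _ _ _ p0 q0 M0) h2.
  apply/(lor_finP _ _ _ _ p0 q0); first by rewrite mulr_ge0.
  apply: (@le_trans _ _ (p%:E * ((2 `^ q)%:E * (lint p q d1 + lint p q d2)))%E).
    apply: lee_wpmul2l; first by rewrite lee_fin ltW.
    rewrite -ge0_integralD//; last 5 first.
    - exact: measurable_pos.
    - by move=> t /= t0; exact: lint_fun_ge0.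
    - exact: lint_fun_measurable.
    - by move=> t /= t0; exact: lint_fun_ge0.
    - exact: lint_fun_measurable.
    rewrite -ge0_integralZl_EFin ?powR_ge0//; last 3 first.
    - exact: measurable_pos.
    - by move=> t /= t0; rewrite adde_ge0//; exact: lint_fun_ge0.
    - by apply: emeasurable_funD; exact: lint_fun_measurable.
    apply: ge0_le_integral.
    - exact: measurable_pos.
    - by move=> t /= t0; exact: lint_fun_ge0.
    - by apply: (lint_fun_measurable p q _ (dist_funD _ _ dd1 dd2)).
    - apply: emeasurable_funM => //.
      by apply: emeasurable_funD; exact: lint_fun_measurable.
    move=> t /= t0; rewrite -ge0_muleDl ?poweR_ge0// muleA.
    apply: lee_wpmul2r; first by rewrite lee_fin invr_ge0 ltW.
    apply: (@le_trans _ _ (poweR (2%:E * maxe (t%:E * poweR (d1 t) p^-1)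
                                  (t%:E * poweR (d2 t) p^-1)) q)%E).
      apply: ge0_le_poweR (pt _ t0); first exact: ltW.
      by rewrite mule_ge0 ?poweR_ge0// lee_fin ltW.
    have a0 (x : \bar R) : (0 <= t%:E * poweR x p^-1)%E.
      by rewrite mule_ge0 ?poweR_ge0// lee_fin ltW.
    rewrite poweRM//; last by rewrite le_max a0.
    rewrite poweR_EFin; apply: lee_wpmul2l; first by rewrite lee_fin powR_ge0.
    by rewrite /maxe; case: ifPn => _; rewrite ?leeDl ?leeDr ?poweR_ge0.
  rewrite muleCA ge0_muleDr ?lint_ge0//.
  apply: (@le_trans _ _ ((2 `^ q)%:E * ((M `^ q)%:E + (M `^ q)%:E))%E).
    by apply: lee_wpmul2l; [rewrite lee_fin powR_ge0|exact: leeD].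
  rewrite -EFinD -EFinM lee_fin (_ : 4 * M = 2 * (2 * M)); last by ring.
  rewrite [leRHS]powRM ?mulr_ge0// ler_wpM2l ?powR_ge0// powRM//.
  have two : 2 <= 2 `^ q :> R by rewrite le1r_powR// ler1n.
  by have := powR_ge0 M q; nra.
move=> /lor_yP h1 /lor_yP h2; apply/lor_yP => t t0.
apply: le_trans (pt _ t0) _.
apply: (@le_trans _ _ (2%:E * M%:E)%E).
  by apply: lee_wpmul2l => //; rewrite ge_max h1// h2.
by rewrite -EFinM lee_fin; nra.
Qed.

(** On []t/2, t]] monotonicity gives [d s >= d t], so this window alone contributes at least half of
    [((t/2) d(t)^{1/p})^q]. One factor 2 undoes [t/2], the other absorbs the half through
    [2 <= 2^q]. *)
Lemma lor_embed_y p q d M : 1 <= p -> 1 <= q -> 0 <= M -> dist_fun d ->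
  (lor p q%:E d <= M%:E)%E -> (lor p +oo d <= (4 * M)%:E)%E.
Proof.
move=> p1 q1 M0 dd.
have p0 : 0 < p by exact: lt_le_trans p1.
have q0 : 0 < q by exact: lt_le_trans q1.
move=> /(lor_finP _ _ _ _ p0 q0 M0) h.
apply/lor_yP => t t0.
set X := poweR (d t) p^-1.
have X0 : (0 <= X)%E by exact: poweR_ge0.
have t20 : 0 < t / 2 by rewrite divr_gt0.
have tX0 : (0 <= (t / 2)%:E * X)%E by rewrite mule_ge0// lee_fin ltW.
have I : (2^-1%:E * poweR ((t / 2)%:E * X) q <= lint p q d)%E.
  have mI : measurable (`](t / 2), t] : set R) by [].
  have I1 : (2^-1%:E * poweR ((t / 2)%:E * X) q <=
      \int[@lebesgue_measure R]_(s in `](t / 2)%R, t])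
        (poweR ((t / 2)%:E * X) q * ((t^-1)%R)%:E))%E.
    rewrite integral_cst//= lebesgue_measure_itv/= lte_fin.
    rewrite (_ : (t / 2 < t) = true); last by lra.
    rewrite -EFinB -muleA -EFinM (_ : t^-1 * (t - t / 2) = 2^-1).
      by rewrite muleC.
    by field; rewrite gt_eqF.
  have sub : `](t / 2), t] `<=` D0.
    by move=> s /=; rewrite in_itv/= => /andP[ts _]; exact: lt_trans ts.
  apply: (le_trans I1).
  have I2 : (\int[@lebesgue_measure R]_(s in `](t / 2)%R, t])
        (poweR ((t / 2)%:E * X) q * ((t^-1)%R)%:E) <=
      \int[@lebesgue_measure R]_(s in `](t / 2)%R, t])
        (poweR (s%:E * poweR (d s) (p^-1)%R) q * ((s^-1)%R)%:E))%E.
    apply: ge0_le_integral => //.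
    - by move=> s _; exact: lint_fun_ge0.
    - apply: (measurable_funS measurable_pos sub).
      exact: lint_fun_measurable.
    move=> s /=; rewrite in_itv/= => /andP[ts st].
    have s0 : 0 < s by exact: lt_trans ts.
    apply: lee_pmul; rewrite ?poweR_ge0 ?lee_fin ?invr_ge0 ?(ltW t0)//.
      apply: ge0_le_poweR => //; first exact: ltW.
      apply: lee_pmul => //; rewrite ?lee_fin ?(ltW ts) ?(ltW t20)//.
      by apply: ge0_le_poweR; [rewrite invr_ge0 ltW|exact: dd.1|exact: dd.2].
    by rewrite lef_pV2 ?posrE.
  apply: (le_trans I2); apply: ge0_subset_integral => //.
  - exact: measurable_pos.
  - exact: lint_fun_measurable.
  - by move=> s /= s0; exact: lint_fun_ge0.
have H : (poweR ((t / 2)%:E * X) q <= poweR (2 * M)%:E q)%E.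
  rewrite poweR_EFin powRM// -(@lee_pmul2l _ 2^-1%:E)//.
  apply: (le_trans I); apply: (@le_trans _ _ (p%:E * lint p q d)%E).
    by rewrite -[leLHS]mul1e; apply: lee_wpmul2r; [exact: lint_ge0|rewrite lee_fin].
  apply: (le_trans h); rewrite -EFinM lee_fin mulrA -[leLHS]mul1r.
  rewrite ler_wpM2r ?powR_ge0// -[leLHS](@mulVf _ 2)// ler_wpM2l//.
  by rewrite le1r_powR// ler1n.
have := @ge0_le_poweR q^-1 _ _ _ (poweR_ge0 _ _) H.
rewrite -!poweRrM mulfV ?gt_eqF// !poweRe1 ?lee_fin ?mulr_ge0//.
move=> /(_ _)/wrap[|K]; first by rewrite invr_ge0 ltW.
rewrite (_ : t = 2 * (t / 2)); last by field.
rewrite (_ : 4 * M = 2 * (2 * M)); last by ring.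
by rewrite EFinM -muleA [leRHS]EFinM lee_wpmul2l.
Qed.

End distribution_functions.

(** * Embeddings in the second exponent, and dilations *)

Section dilation.
Context {R : realType}.
Implicit Types (p q r s t M : R) (d : R -> \bar R).
Local Notation D0 := [set t : R | 0 < t].

(** With [g = t d(t)^{1/p}], the weak bound [g <= 4M] gives [g^r <= (4M)^{r-q} g^q]. *)
Lemma lor_embed p (q r : \bar R) d M : 1 <= p -> (1 <= q)%E -> (q <= r)%E ->
  0 <= M -> dist_fun d ->
  (lor p q d <= M%:E)%E -> (lor p r d <= (4 * M)%:E)%E.
Proof.
move=> p1 q1 qr M0 dd h.
have MM : (M%:E <= (4 * M)%:E)%E by rewrite lee_fin; lra.
have [<-|nqr] := eqVneq q r; first exact: le_trans MM.
have {qr nqr} qr : (q < r)%E by rewrite lt_neqAle nqr.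
case: q q1 qr h => [q q1 qr h||//]; last by case: r.
rewrite lee_fin in q1.
have p0 : 0 < p by exact: lt_le_trans p1.
have q0 : 0 < q by exact: lt_le_trans q1.
have hy := lor_embed_y p q d M p1 q1 M0 dd h.
case: r qr => [r qr|_|//]; last exact: hy.
rewrite lte_fin in qr.
have r0 : 0 < r by exact: lt_trans qr.
move/(lor_finP _ _ _ _ p0 q0 M0) : h => h.
apply/(lor_finP _ _ _ _ p0 r0); first by rewrite mulr_ge0.
have M40 : 0 <= 4 * M by rewrite mulr_ge0.
have I : (lint p r d <= ((4 * M) `^ (r - q))%:E * lint p q d)%E.
  rewrite -ge0_integralZl_EFin ?powR_ge0//; last 3 first.
  - exact: measurable_pos.
  - by move=> t /= t0; exact: lint_fun_ge0.
  - exact: lint_fun_measurable.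
  apply: ge0_le_integral.
  - exact: measurable_pos.
  - by move=> t /= t0; exact: lint_fun_ge0.
  - exact: lint_fun_measurable.
  - by apply: emeasurable_funM => //; exact: lint_fun_measurable.
  move=> t /= t0; rewrite muleA; apply: lee_wpmul2r.
    by rewrite lee_fin invr_ge0 ltW.
  rewrite -[in leLHS](subrK q r) poweRD; last first.
    by rewrite add_neq0_poweRD_def// subrK gt_eqF.
  apply: lee_wpmul2r; first exact: poweR_ge0.
  rewrite -poweR_EFin; apply: ge0_le_poweR.
  - by rewrite subr_ge0 ltW.
  - by rewrite mule_ge0 ?poweR_ge0// lee_fin ltW.
  - by move/lor_yP : hy; apply.
apply: (@le_trans _ _ (p%:E * (((4 * M) `^ (r - q))%:E * lint p q d))%E).
  by apply: lee_wpmul2l; [rewrite lee_fin ltW|].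
rewrite muleCA.
apply: (@le_trans _ _ (((4 * M) `^ (r - q))%:E * (M `^ q)%:E)%E).
  by apply: lee_wpmul2l; [rewrite lee_fin powR_ge0|].
rewrite -EFinM lee_fin -[in leRHS](subrK q r) [leRHS]powRD; last first.
  by rewrite subrK gt_eqF.
rewrite ler_wpM2l ?powR_ge0// ge0_ler_powR ?nnegrE//; exact: ltW.
Qed.

Lemma measurable_half :
  measurable_fun [set: measurableTypeR R] (fun x => x / 2 : measurableTypeR R).
Proof. exact: measurable_funM. Qed.

(** The pushforward of Lebesgue measure under [t -> t/2] is twice Lebesgue measure: this is checked
    on half-open intervals and extended by uniqueness. *)
Lemma ge0_integral_half (f : R -> \bar R) : measurable_fun D0 f ->
  (forall t, 0 < t -> (0 <= f t)%E) ->
  (\int[@lebesgue_measure R]_(t in D0) f (t / 2)%R =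
   2%:E * \int[@lebesgue_measure R]_(t in D0) f t)%E.
Proof.
move=> mf f0.
pose mphi := isMeasurableFun.Build _ _ _ _ _ measurable_half.
pose phi : {mfun (measurableTypeR R) >-> (measurableTypeR R)} :=
  HB.pack (fun x : R => x / 2) mphi.
pose nu := pushforward (@lebesgue_measure R) phi.
have nuE A : measurable A -> nu A = mscale 2%:nng (@lebesgue_measure R) A.
  move=> mA; rewrite /mscale/=.
  rewrite (@lebesgue_measure_unique _ (mscale 2^-1%:nng nu))//.
    by rewrite /mscale/= muleA -EFinM mulfV// mul1e.
  move=> _ [[a b]] _ <-.
  change (lebesgue_measure `]a, b]%classic =
    2^-1%:E * lebesgue_measure (phi @^-1` `]a, b]%classic))%E.
  rewrite (_ : phi @^-1` _ = `](2 * a), (2 * b)]%classic); last first.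
    by apply/seteqP; split=> x /=; rewrite !in_itv/=; lra.
  rewrite !lebesgue_measure_itv/= !lte_fin ltr_pM2l//.
  case: ifPn => _; last by rewrite mule0.
  by rewrite -!EFinB -EFinM; congr EFin; field.
have preE : phi @^-1` D0 = D0 by apply/seteqP; split=> x /=; lra.
transitivity (\int[nu]_(t in D0) f t)%E.
  rewrite (ge0_integral_pushforward measurable_half)//=.
  - by rewrite -[in LHS]preE.
  - exact: measurable_pos.
  - by move=> t; rewrite inE => /f0.
rewrite (eq_measure_integral (mscale 2%:nng (@lebesgue_measure R))); last first.
  by move=> A mA _; exact: nuE.
by rewrite ge0_integral_mscale//; exact: measurable_pos.
Qed.

Lemma dist_fun_half d : dist_fun d -> dist_fun (fun t => d (t / 2)).
Proof. by move=> [d0 dn]; split=> [//|s t st]; apply: dn; rewrite ler_pM2r. Qed.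

Lemma lor_half p (q : \bar R) d M : 1 <= p -> (1 <= q)%E ->
  0 <= M -> dist_fun d ->
  (lor p q d <= M%:E)%E -> (lor p q (fun t => d (t / 2)%R) <= (2 * M)%:E)%E.
Proof.
move=> p1 q1 M0 dd.
have p0 : 0 < p by exact: lt_le_trans p1.
case: q q1 => [q q1|_|//].
  rewrite lee_fin in q1.
  have q0 : 0 < q by exact: lt_le_trans q1.
  move=> /(lor_finP _ _ _ _ p0 q0 M0) h; apply/(lor_finP _ _ _ _ p0 q0).
    by rewrite mulr_ge0.
  suff -> : lint p q (fun t => d (t / 2)) = ((2 `^ q)%:E * lint p q d)%E.
    by rewrite muleCA powRM// EFinM lee_wpmul2l// lee_fin powR_ge0.
  pose g (t : R) := (poweR (t%:E * poweR (d t) p^-1) q * (t^-1)%:E)%E.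
  have mg : measurable_fun D0 g by exact: lint_fun_measurable.
  (* The factor [2^q] comes from [t = 2 (t/2)] and the division by 2 from [1/t]; the latter cancels
     against the Jacobian of the substitution. *)
  transitivity (\int[@lebesgue_measure R]_(t in D0)
      ((2 `^ q / 2)%:E * g (t / 2)%R))%E.
    apply: eq_integral => t; rewrite inE/= => t0; rewrite /g.
    set D := poweR (d (t / 2)) p^-1.
    have D0 : (0 <= D)%E by exact: poweR_ge0.
    have t20 : 0 < t / 2 by rewrite divr_gt0.
    have -> : (t%:E * D = 2%:E * ((t / 2)%:E * D))%E.
      by rewrite muleA -EFinM; congr (_%:E * _)%E; field.
    rewrite poweRM ?mule_ge0 ?lee_fin ?(ltW t20)// poweR_EFin.
    rewrite [RHS]muleCA -muleA [LHS]muleCA -!EFinM; congr (_ * _%:E)%E.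
    by field; rewrite gt_eqF.
  rewrite ge0_integralZl_EFin; last 4 first.
  - exact: measurable_pos.
  - by move=> t /= t0; apply: lint_fun_ge0; rewrite divr_gt0.
  - apply: (measurable_comp measurable_pos _ mg).
      by move=> _ [t /= t0 <-]; rewrite divr_gt0.
    by apply: measurable_funTS; exact: measurable_half.
  - by rewrite divr_ge0 ?powR_ge0.
  rewrite ge0_integral_half//; last by move=> t t0; exact: lint_fun_ge0.
  by rewrite muleA -EFinM divfK.
move=> /lor_yP h; apply/lor_yP => t t0.
rewrite [in leLHS](_ : t%:E = (2%:E * (t / 2)%:E)%E); last first.
  by rewrite -EFinM; congr EFin; field.
rewrite -muleA [leRHS]EFinM; apply: lee_wpmul2l => //.
by apply: h; rewrite divr_gt0.
Qed.

End dilation.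

(** Membership in [l^r], meant for nonnegative sequences: hence no absolute value, and only an upper
    bound at [+oo]. *)
Definition fin_seq {R : realType} (r : \bar R) (x : nat -> R) : Prop :=
  match r with
  | r'%:E => (\sum_(0 <= k <oo) ((x k `^ r')%R)%:E < +oo)%E
  | +oo%E => exists B : R, forall k, x k <= B
  | -oo%E => True
  end.

(** * Quasinorms of step functions and summability of sequences *)

Section step_functions.
Context {R : realType}.
Implicit Types (p q r s t M : R) (d : R -> \bar R).
Local Notation D0 := [set t : R | 0 < t].

Lemma nneseries_ge_term (u : nat -> \bar R) k : (forall n, (0 <= u n)%E) ->
  (u k <= \sum_(0 <= n <oo) u n)%E.
Proof.
move=> u0; rewrite (@nneseriesD1 _ _ k xpredT)//=.
by rewrite leeDl//; apply: nneseries_ge0.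
Qed.

Lemma nneseries_le (u : nat -> R) (M : R) : (forall n, 0 <= u n) ->
  (forall n, \sum_(0 <= k < n) u k <= M) ->
  (\sum_(0 <= n <oo) (u n)%:E <= M%:E)%E.
Proof.
move=> u0 uM; apply: lime_le.
  by apply: is_cvg_nneseries => n _ _; rewrite lee_fin.
by apply: nearW => n; rewrite sumEFin lee_fin.
Qed.

Lemma le_fin_seq (r : \bar R) (x y : nat -> R) (C : R) : (1 <= r)%E -> 0 <= C ->
  (forall k, 0 <= x k) -> (forall k, 0 <= y k) -> (forall k, x k <= C * y k) ->
  fin_seq r y -> fin_seq r x.
Proof.
move=> r1 C0 x0 y0 xy; case: r r1 => [r r1|_|//] /=; last first.
  move=> [B yB]; exists (C * B) => k; apply: le_trans (xy k) _.
  by rewrite ler_wpM2l.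
rewrite lee_fin in r1.
have r0 : 0 <= r by exact: le_trans r1.
move=> h; apply: (@le_lt_trans _ _
    (\sum_(0 <= k <oo) ((C `^ r)%:E * (y k `^ r)%:E))%E).
  apply: lee_nneseries => k _ => [_|]; first by rewrite lee_fin powR_ge0.
  by rewrite -EFinM lee_fin -powRM// ge0_ler_powR ?nnegrE ?mulr_ge0.
rewrite nneseriesZl; last by move=> k _; rewrite lee_fin powR_ge0.
by rewrite lte_mul_pinfty// lee_fin powR_ge0.
Qed.

Lemma fin_seq_geometric (r : \bar R) : (1 <= r)%E ->
  fin_seq r (fun k => (2 ^+ k)^-1 : R).
Proof.
have le1 k : (2 ^+ k)^-1 <= 1 :> R.
  by rewrite invf_le1 ?exprn_gt0// exprn_ege1// ler1n.
case: r => [r r1|_|//] /=; last by exists 1.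
rewrite lee_fin in r1; apply: le_lt_trans (ltry 2).
apply: nneseries_le => [n|n]; first exact: powR_ge0.
apply: (@le_trans _ _ (2 - (2 ^+ n)^-1 * 2)); last first.
  by rewrite gerBl mulr_ge0// invr_ge0 exprn_ge0.
elim: n => [|n IH]; first by rewrite big_geq// expr0 invr1 mul1r subrr.
rewrite big_nat_recr//=; apply: le_trans (lerD IH (_ : _ <= (2 ^+ n)^-1)) _.
  by apply: ge1r_powR => //; rewrite invr_gt0 exprn_gt0/=.
by rewrite exprS invfM; lra.
Qed.

(* [r >= 1] lets [t `^ (r - 1)] be bounded by its value at the right end of
   each step, so that the integral of the step function is at most the series *)
Lemma lor_step p (r : \bar R) (c T : nat -> R) : 1 <= p -> (1 <= r)%E ->
  (forall k, 0 <= c k) -> (forall k, 0 <= T k) ->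
  fin_seq r (fun k => c k * T k `^ p^-1) ->
  exists2 K : R, 0 <= K & forall (lam : R) d, 0 <= lam -> dist_fun d ->
    (forall t, 0 < t ->
       d t = 0%E \/ exists k, t < lam * c k /\ (d t <= (T k)%:E)%E) ->
    (lor p r d <= (K * lam)%:E)%E.
Proof.
move=> p1 r1 c0 T0.
have p0 : 0 < p by exact: lt_le_trans p1.
have pV0 : 0 <= p^-1 by rewrite invr_ge0 ltW.
have u0 k : 0 <= T k `^ p^-1 by exact: powR_ge0.
case: r r1 => [r r1|_|//] /=; last first.
  move=> [B xB]; exists (Num.max B 0); first by rewrite le_max lexx orbT.
  move=> lam d l0 dd H; apply/lor_yP => t t0.
  have [->|[k [tk dk]]] := H _ t0.
    rewrite poweR0r ?invr_eq0 ?gt_eqF// mule0 lee_fin mulr_ge0//.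
    by rewrite le_max lexx orbT.
  apply: (@le_trans _ _ (t%:E * poweR (T k)%:E p^-1)%E).
    apply: lee_wpmul2l; first by rewrite lee_fin ltW.
    by apply: ge0_le_poweR => //; exact: dd.1.
  rewrite poweR_EFin -EFinM lee_fin mulrC.
  apply: (@le_trans _ _ (lam * (c k * T k `^ p^-1))).
    by rewrite mulrA mulrC ler_wpM2r// ltW.
  by rewrite [leRHS]mulrC ler_wpM2l// le_max xB.
rewrite lee_fin in r1.
have r0 : 0 < r by exact: lt_le_trans r1.
set S := (X in (X < _)%E) => Soo.
have S0 : (0 <= S)%E by apply: nneseries_ge0 => k _ _; rewrite lee_fin powR_ge0.
have [s sE] : exists s, S = s%:E.
  by exists (fine S); rewrite fineK// ge0_fin_numE.
have s0 : 0 <= s by rewrite -lee_fin -sE.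
exists ((p * s) `^ r^-1); first exact: powR_ge0.
move=> lam d l0 dd H; apply/lor_finP => //; first by rewrite mulr_ge0// powR_ge0.
rewrite powRM ?powR_ge0// -powRrM mulVf ?gt_eqF// powRr1 ?mulr_ge0 ?(ltW p0)//.
rewrite -mulrA EFinM; apply: lee_wpmul2l; first by rewrite lee_fin ltW.
(* The index that [H] attaches to [t] is not a measurable choice, so the integrand is compared with
   the sum over all indices, each term spread over the whole of []0, lam * c k]]. *)
pose a k : R := (lam * c k) `^ (r - 1) * (T k `^ p^-1) `^ r.
have a0 k : 0 <= a k by rewrite mulr_ge0 ?powR_ge0.
pose g k (t : R) := ((a k)%:E * (\1_(`]0%R, lam * c k] : set R) t)%:E)%E.
have g0 k t : (0 <= g k t)%E by rewrite mule_ge0 ?lee_fin.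
have mg k : measurable_fun D0 (g k).
  apply: emeasurable_funM => //; apply/measurable_EFinP.
  by apply: measurable_funTS; exact: measurable_indic.
apply: (@le_trans _ _ (\int[@lebesgue_measure R]_(t in D0)
    (\sum_(0 <= k <oo) g k t))%E).
  apply: ge0_le_integral.
  - exact: measurable_pos.
  - by move=> t /= t0; exact: lint_fun_ge0.
  - exact: lint_fun_measurable.
  - exact: (@ge0_emeasurable_sum _ _ _ D0 g xpredT
      (fun k t _ _ => g0 k t) (fun k _ => mg k)).
  move=> t /= t0.
  have [->|[k [tk dk]]] := H _ t0.
    rewrite poweR0r ?invr_eq0 ?gt_eqF// mule0 poweR0r ?gt_eqF// mul0e.
    by apply: nneseries_ge0.
  apply: le_trans (nneseries_ge_term _ k (fun n => g0 n t)).
  rewrite /g indicE mem_set ?mule1; last by rewrite /= in_itv/= t0 ltW.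
  apply: (@le_trans _ _ (poweR (t%:E * poweR (T k)%:E p^-1) r * (t^-1)%:E)%E).
    apply: lee_wpmul2r; first by rewrite lee_fin invr_ge0 ltW.
    apply: ge0_le_poweR; first exact: ltW.
      by rewrite mule_ge0 ?poweR_ge0// lee_fin ltW.
    apply: lee_wpmul2l; first by rewrite lee_fin ltW.
    by apply: ge0_le_poweR => //; exact: dd.1.
  change (((t * T k `^ p^-1) `^ r * t^-1)%:E <= (a k)%:E)%E.
  rewrite lee_fin powRM ?(ltW t0)//.
  rewrite mulrAC /a -(@mulr_powRB1 _ t r) ?(ltW t0)//.
  rewrite (_ : t * t `^ (r - 1) / t = t `^ (r - 1)); last by field; rewrite gt_eqF.
  rewrite ler_wpM2r ?powR_ge0// ge0_ler_powR ?nnegrE ?subr_ge0 ?(ltW t0) ?(ltW tk)//.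
  by rewrite mulr_ge0.
rewrite integral_nneseries//; last exact: measurable_pos.
apply: (@le_trans _ _ (\sum_(0 <= k <oo)
    ((lam `^ r)%:E * ((c k * T k `^ p^-1) `^ r)%:E))%E).
  apply: lee_nneseries => k _ => [_|]; first by apply: integral_ge0.
  rewrite ge0_integralZl_EFin//; last 2 first.
  - exact: measurable_pos.
  - apply/measurable_EFinP.
    by apply: measurable_funTS; exact: measurable_indic.
  rewrite integral_indic//; last exact: measurable_pos.
  rewrite (_ : _ `&` _ = `]0%R, lam * c k]%classic); last first.
    apply/seteqP; split=> x /=; rewrite in_itv/=; first by case.
    by move=> /andP[? ?]; split=> //; apply/andP.
  have lc0 : 0 <= lam * c k by rewrite mulr_ge0.
  rewrite [X in (_ * X)%E]lebesgue_measure_itv/= lte_fin; case: ifPn => lc; last first.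
    by rewrite mule0 -EFinM lee_fin mulr_ge0 ?powR_ge0.
  rewrite -EFinB -!EFinM lee_fin subr0 /a mulrAC [X in X * _]mulrC.
  by rewrite mulr_powRB1// !powRM// mulrA.
rewrite nneseriesZl; last by move=> k _; rewrite lee_fin powR_ge0.
by rewrite -/S sE -EFinM mulrC.
Qed.

(** The halving of [c] makes the windows [[c k / 2, c k[] disjoint, and each of them contributes a
    fixed multiple of the [k]-th term of the divergent series. At [+oo] the left ends of the windows
    are test levels. *)
Lemma lor_step_infty p (r : \bar R) (c T : nat -> R) d : 1 <= p -> (1 <= r)%E ->
  (forall k, 0 < c k) -> (forall k, c k.+1 <= c k / 2) ->
  (forall k, 0 <= T k) -> dist_fun d ->
  (forall k t, 0 < t -> t < c k -> ((T k)%:E <= d t)%E) ->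
  ~ fin_seq r (fun k => c k * T k `^ p^-1) -> lor p r d = +oo%E.
Proof.
move=> p1 r1 c0 ch T0 dd H.
have p0 : 0 < p by exact: lt_le_trans p1.
have pV0 : 0 <= p^-1 by rewrite invr_ge0 ltW.
have u0 k : 0 <= T k `^ p^-1 by exact: powR_ge0.
have c20 k : 0 < c k / 2 by rewrite divr_gt0.
have pt k t : c k / 2 <= t -> t < c k ->
    (((c k / 2) * T k `^ p^-1)%:E <= t%:E * poweR (d t) p^-1)%E.
  move=> kt tk; have t0 : 0 < t by exact: lt_le_trans kt.
  rewrite EFinM; apply: lee_pmul; rewrite ?lee_fin ?(ltW (c20 k))//.
  change (poweR (T k)%:E p^-1 <= poweR (d t) p^-1)%E.
  by apply: ge0_le_poweR; rewrite ?lee_fin// H.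
case: r r1 => [r r1|_|//] /=; last first.
  move=> nb; apply/eqP; rewrite eq_le leey/= leNgt; apply/negP => lt.
  have := lor_ge0 p +oo%E d (ltW p0) => /= l0.
  set L := (X in (X < _)%E) in lt.
  apply: nb; exists (2 * fine L) => k.
  suff : ((c k / 2 * T k `^ p^-1)%:E <= L)%E.
    rewrite -(@fineK _ L) ?ge0_fin_numE// lee_fin; lra.
  apply: le_trans (pt k (c k / 2) _ _) _ => //; first by have := c0 k; lra.
  by apply: ereal_sup_ubound; exists (c k / 2) => //=.
rewrite lee_fin in r1.
have r0 : 0 < r by exact: lt_le_trans r1.
move/negP; rewrite -leNgt leye_eq => /eqP Soo.
suff -> : lint p r d = +oo%E.
  by rewrite poweRyr ?invr_eq0 ?gt_eqF// gt0_muley// lte_fin powR_gt0.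
pose F k : set R := `[c k / 2, c k[%classic.
have mF k : measurable (F k) by exact: measurable_itv.
have FD : \bigcup_k F k `<=` D0.
  by move=> t [k _]; rewrite /F/= in_itv/= => /andP[kt _]; exact: lt_le_trans kt.
have cdec m n : (m < n)%N -> c n <= c m / 2.
  elim: n => // n IH; rewrite ltnS leq_eqVlt => /predU1P[->|/IH h]; first exact: ch.
  by apply: le_trans (ch n) _; have := c0 n; have := c0 m; lra.
have tF : trivIset setT F.
  apply/trivIsetP => i j _ _; wlog ij : i j / (i < j)%N => [W|_].
    by rewrite neq_ltn => /orP[]ij; [|rewrite setIC]; apply: W; rewrite // ?ltn_eqF // gtn_eqF.
  apply/seteqP; split=> // t []; rewrite /F/= !in_itv/= => /andP[it _] /andP[_ tj].
  by have := cdec _ _ ij; move: it tj; lra.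
apply/eqP; rewrite eq_le leey/=.
have mL : measurable_fun D0 (fun t =>
    (poweR (t%:E * poweR (d t) p^-1) r * (t^-1)%:E)%E).
  exact: lint_fun_measurable.
have mU : measurable (\bigcup_k F k) by exact: bigcupT_measurable.
have I1 := @ge0_subset_integral _ _ _ (@lebesgue_measure R) _ _ mU
  measurable_pos _ mL (fun t => lint_fun_ge0 r t _) FD.
apply: le_trans I1.
rewrite ge0_integral_bigcup//; last 2 first.
- exact: (measurable_funS measurable_pos FD).
- by move=> t /FD /= t0; exact: lint_fun_ge0.
(* On window [k], [t >= c k / 2] costs the factor [2^{-r}], and [1/t >= 1 / c k] against the length
   [c k / 2] costs [1/2]. *)
rewrite -(_ : (\sum_(0 <= k <oo)
    ((2^-1 * 2^-1 `^ r)%:E * ((c k * T k `^ p^-1) `^ r)%:E))%E = +oo%E); last first.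
  rewrite nneseriesZl; last by move=> k _; rewrite lee_fin powR_ge0.
  by rewrite Soo gt0_muley// lte_fin mulr_gt0// powR_gt0.
apply: lee_nneseries => k _ => [_|].
  by rewrite -EFinM lee_fin !mulr_ge0 ?powR_ge0.
have I2 : (\int[@lebesgue_measure R]_(t in F k)
    (((c k / 2 * T k `^ p^-1) `^ r * (c k)^-1)%R)%:E <=
  \int[@lebesgue_measure R]_(t in F k)
    (poweR (t%:E * poweR (d t) (p^-1)%R) r * (t^-1%R)%:E))%E.
  have FkD : F k `<=` D0 by move=> t Ft; apply: FD; exists k.
  apply: ge0_le_integral => //.
  - exact: measurable_itv.
  - by move=> t _; rewrite lee_fin mulr_ge0 ?powR_ge0// invr_ge0 ltW.
  - exact: (measurable_funS measurable_pos FkD).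
  move=> t; rewrite /F/= in_itv/= => /andP[kt tk].
  have t0 : 0 < t by exact: lt_le_trans kt.
  rewrite EFinM; apply: lee_pmul; rewrite ?lee_fin ?powR_ge0 ?invr_ge0 ?(ltW (c0 k))//.
    change (poweR (c k / 2 * T k `^ p^-1)%:E r <=
      poweR (t%:E * poweR (d t) p^-1) r)%E.
    apply: ge0_le_poweR; [exact: ltW| |exact: pt].
    by rewrite lee_fin mulr_ge0// ltW.
  by rewrite lef_pV2 ?posrE// ltW.
apply: le_trans I2.
rewrite integral_cst; last exact: measurable_itv.
rewrite /F [X in (_ <= _ * X)%E]lebesgue_measure_itv/= lte_fin.
rewrite (_ : (c k / 2 < c k) = true); last by have := c0 k; lra.
rewrite -EFinB -!EFinM lee_fin.
rewrite (_ : c k / 2 * T k `^ p^-1 = 2^-1 * (c k * T k `^ p^-1)); last by ring.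
rewrite [X in _ <= X / _ * _]powRM ?mulr_ge0 ?(ltW (c0 k))//.
by rewrite le_eqVlt; apply/orP; left; apply/eqP; field; rewrite gt_eqF.
Qed.

End step_functions.

(** * The metric space *)

Definition weighted {R : realType} {dT : measure_display} {T : measurableType dT}
  (w : T -> {nonneg R}) (A : set T) : \bar R := \esum_(u in A) (w u)%:num%:E.

Section weighted_measure.
Local Open Scope ereal_scope.
Context {R : realType} {dT : measure_display} {T : measurableType dT}.
Context (w : T -> {nonneg R}).

Let weighted0 : weighted w set0 = 0.
Proof. by rewrite /weighted esum_set0. Qed.

Let weighted_ge0 A : 0 <= weighted w A.
Proof. by apply: esum_ge0 => u _; rewrite lee_fin. Qed.

Let weighted_sigma_additive : semi_sigma_additive (weighted w).
Proof.
move=> F mF tF mU; rewrite /weighted nneseries_sum_bigcup//.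
by apply: is_cvg_nneseries => n _ _; exact: weighted_ge0.
Qed.

HB.instance Definition _ := isMeasure.Build _ _ _ (weighted w)
  weighted0 weighted_ge0 weighted_sigma_additive.

Lemma weighted1 u : weighted w [set u] = (w u)%:num%:E.
Proof. by rewrite /weighted esum_set1. Qed.

End weighted_measure.

Definition vertex (N : nat -> nat) : Type := option ({k : nat & 'I_(N k)} * bool).

HB.instance Definition _ N := Choice.on (vertex N).
HB.instance Definition _ N := isPointed.Build (vertex N) None.
(** All sets are measurable. This is the Borel algebra of the metric below, whose open balls of
    radius 1 are singletons. *)
HB.instance Definition _ N := @isMeasurable.Build default_measure_display
  (vertex N) discrete_measurable discrete_measurable0
  discrete_measurableC discrete_measurableU.

Section geometry.
Context {N : nat -> nat}.
Implicit Types (u v : vertex N) (k n : nat).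

(* [None] is the centre; the pair number [i] of stage [k] is [(inner k i, outer k i)]. *)
Definition inner k (i : 'I_(N k)) : vertex N := Some (existT _ k i, true).
Definition outer k (i : 'I_(N k)) : vertex N := Some (existT _ k i, false).

Definition stage u : nat := if u is Some (existT k _, _) then k else 0%N.
Definition is_inner u : bool := if u is Some (_, b) then b else false.
Definition is_outer u : bool := if u is Some (_, b) then ~~ b else false.
Definition swap u : vertex N := if u is Some (x, b) then Some (x, ~~ b) else None.

(** The shift by one leaves height 0 to the centre and the inner atoms, one step below the outer
    atoms of stage 0. *)
Definition height u : nat := if is_outer u then (stage u).+1 else 0%N.
Definition depth u : nat := if is_inner u then (stage u).+1 else 0%N.
Definition near_pair u v : bool :=
  is_inner u && ((v == None) || (v == swap u)) ||
  is_inner v && ((u == None) || (u == swap v)).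

(* The [height] term gives the outer atoms of consecutive stages distance [1], so
   that a nontrivial ball about an outer atom reaches the next stage; the [depth]
   term makes the ball about an inner atom of stage [k] a singleton up to radius
   [k + 1], and equal to a [near_pair] neighbourhood up to radius [k + 2]. *)
Definition ndist u v : nat :=
  maxn ((height u - height v) + (height v - height u))
       (if u == v then 0 else (maxn (depth u) (depth v) + ~~ near_pair u v)%N).

Definition pdist {R : realType} u v : R := (ndist u v)%:R.

Lemma swapK : involutive swap.
Proof. by case=> [[x b]|]//=; rewrite negbK. Qed.

Lemma near_pairC u v : near_pair u v = near_pair v u.
Proof. by rewrite /near_pair orbC. Qed.

Lemma ndistC u v : ndist u v = ndist v u.
Proof.
by rewrite /ndist near_pairC (eq_sym u v) (maxnC (depth u)) [X in maxn X]addnC.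
Qed.

Lemma near_pair_depth u v : near_pair u v -> (0 < maxn (depth u) (depth v))%N.
Proof.
rewrite /near_pair /depth; case: (is_inner u); case: (is_inner v) => //=.
by rewrite leq_max.
Qed.

Lemma ndist_eq0 u v : ndist u v = 0%N <-> u = v.
Proof.
split=> [|->]; last by rewrite /ndist eqxx !subnn.
rewrite /ndist; case: eqVneq => // _.
have := @near_pair_depth u v; case: near_pair => /=; lia.
Qed.

(** The two entries of the maximum are treated separately. For the second one, the possible extra 1
    on the left is paid by a leg that is not a [near_pair]; if both legs are near pairs, each has
    positive [depth] maximum, and the shorter of the two pays. *)
Lemma ndist_triangle u v w : (ndist u w <= ndist u v + ndist v w)%N.
Proof.
rewrite /ndist; case: (eqVneq u w) => [->|uw]; first by lia.
case: (eqVneq u v) => [<-|uv]; first by rewrite (negbTE uw); lia.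
case: (eqVneq v w) => [<-|_]; first by lia.
rewrite geq_max; apply/andP; split.
  by apply: leq_trans (leq_add (leq_maxl _ _) (leq_maxl _ _)); lia.
apply: leq_trans (leq_add (leq_maxr _ _) (leq_maxr _ _)).
have := @near_pair_depth u v; have := @near_pair_depth v w.
by case: (near_pair u v); case: (near_pair v w); case: (near_pair u w) => /=; lia.
Qed.

Lemma pdist_metric (R : realType) : is_metric (@pdist R).
Proof.
split; first by move=> u v; exact: ler0n.
split.
  move=> u v; rewrite /pdist; split=> [/eqP|/ndist_eq0 ->//].
  by rewrite pnatr_eq0 => /eqP/ndist_eq0.
split; first by move=> u v; rewrite /pdist ndistC.
by move=> u v w; rewrite /pdist -natrD ler_nat ndist_triangle.
Qed.

Lemma near_pair_swap u : is_inner u -> near_pair u (swap u).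
Proof. by rewrite /near_pair => ->; rewrite eqxx orbT. Qed.

(** Forgetting [near_pair] changes the distance by at most 1. This bound and the next one suffice
    except for the small balls about inner atoms. *)
Lemma ndist_ub u v : (ndist u v <=
  maxn (height u - height v + (height v - height u)) (maxn (depth u) (depth v)).+1)%N.
Proof. by rewrite /ndist; case: ifP => _; case: (near_pair u v) => /=; lia. Qed.

Lemma ndist_lb u v : u != v ->
  (maxn (height u - height v + (height v - height u)) (maxn (depth u) (depth v))
    <= ndist u v)%N.
Proof. by rewrite /ndist => /negbTE->; case: (near_pair u v) => /=; lia. Qed.

Definition nball u n : set (vertex N) := [set v | (ndist u v <= n)%N].

(** Distances are integers, so [n] is the largest integer below [s], the same for all centres. *)
Lemma oball_nball (R : realType) (s : R) : 0 < s ->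
  exists n, forall u, oball pdist u s = nball u n.
Proof.
move=> s0.
have ex : exists m : nat, m%:R < s by exists 0%N.
have bd m : m%:R < s -> (m <= Num.truncn s)%N.
  by move=> ms; rewrite truncn_ge_nat ?(ltW s0)// ltW.
case: (ex_maxnP ex bd) => n ns nmax; exists n => u.
apply/seteqP; split=> v /=; rewrite /oball /pdist /nball /=; first exact: nmax.
by move=> vn; apply: le_lt_trans ns; rewrite ler_nat.
Qed.

Definition upto K : set (vertex N) := [set v | (stage v <= K)%N].
Definition inners K : set (vertex N) := [set v | is_inner v /\ stage v = K].
Definition outers K : set (vertex N) := [set v | is_outer v /\ stage v = K].

(** The centre has [stage] 0 by convention and is exempted from the strict inequality, because its
    ball of integer radius 1 already ends at stage 0. *)
Definition long_ball u (B : set (vertex N)) K :=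
  [/\ (u == None) || (stage u < K)%N, outers K `<=` B & B `<=` upto K].

Lemma nball_short u : is_inner u ->
  nball u (stage u).+1 = [set u; None; swap u].
Proof.
case: u => [[[k i] []]|]// _; apply/seteqP; split=> v.
  rewrite /nball/= /ndist /=; case: eqVneq => [->|uv]; first by left; left.
  rewrite /depth/= /near_pair/=; case: (eqVneq v None) => [->|v0]; first by left; right.
  case: (eqVneq v (Some _)) => [->|vs]; first by right.
  case: eqVneq => [E|_]; first by move: vs; rewrite -(swapK v) -E eqxx.
  by rewrite andbF; lia.
rewrite /nball/= /ndist => -[[->|->]|->].
+ by rewrite eqxx; rewrite /height/=.
+ by rewrite /height/depth/= /near_pair/=; lia.
+ rewrite near_pair_swap// addn0 /height/depth/=.
  by case: ifP => _; lia.
Qed.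

Lemma nball_cases u n :
  [\/ nball u n = [set u],
      is_inner u /\ nball u n = [set u; None; swap u] |
      exists K, long_ball u (nball u n) K].
Proof.
have self : nball u n u by rewrite /nball/= (ndist_eq0 u u).2.
case: u self => [[[k i] []]|] self.
- have [nk|nk] := leqP n k.
    constructor 1; apply/seteqP; split=> [v /=|v ->//].
    rewrite /nball/= /ndist /=; case: eqVneq => [->//|_].
    by rewrite /depth/=; lia.
  have [->|nk1] := eqVneq n k.+1.
    by constructor 2; split=> //; exact: (nball_short (inner k i)).
  have nk2 : (k.+1 < n)%N by rewrite ltn_neqAle eq_sym nk1.
  clear self nk nk1; case: n nk2 => // n nk2.
  (* The radius is now [n.+1], and the inner atom has height 0: the ball reaches height [n.+1],
     which is the height of the outer atoms of stage [n]. *)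
  constructor 3; exists n; split; first by rewrite /=; lia.
    move=> [[[l j] []]|] [//= _ lE]; rewrite /nball/=.
    by apply: leq_trans (ndist_ub _ _) _; rewrite /height/depth/=; clear -nk2 lE; lia.
  move=> v; rewrite /nball/upto/=.
  have [<- _|/ndist_lb] := eqVneq (Some (existT _ k i, true)) v; first by rewrite /=; lia.
  by case: v => [[[l j] []]|]//; rewrite /height/depth/=; lia.
- have [->|n0] := posnP n.
    constructor 1; apply/seteqP; split=> [v /=|v ->].
      by rewrite /nball/= leqn0 => /eqP/ndist_eq0 ->.
    by rewrite /nball/= (ndist_eq0 _ _).2.
  (* The centre of the ball has height [k.+1], so radius [n] reaches height [(k + n).+1], that of
     stage [k + n]. The positivity of [n] covers the extra 1 in [ndist_ub]. *)
  constructor 3; exists (k + n)%N; split; first by rewrite /=; lia.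
    move=> [[[l j] []]|] [//= _ lE]; rewrite /nball/=.
    by apply: leq_trans (ndist_ub _ _) _; rewrite /height/depth/=; clear -n0 lE; lia.
  move=> v; rewrite /nball/upto/=.
  have [<- _|/ndist_lb] := eqVneq (Some (existT _ k i, false)) v; first by rewrite /=; lia.
  by case: v => [[[l j] []]|]//; rewrite /height/depth/=; lia.
- have [->|n0] := posnP n.
    constructor 1; apply/seteqP; split=> [v /=|v ->].
      by rewrite /nball/= leqn0 => /eqP/ndist_eq0 ->.
    by rewrite /nball/= (ndist_eq0 _ _).2.
  clear self; case: n n0 => // n _.
  constructor 3; exists n; split=> //.
    move=> [[[l j] []]|] [//= _ lE]; rewrite /nball/=.
    by apply: leq_trans (ndist_ub _ _) _; rewrite /height/depth/=; clear -lE; lia.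
  move=> v; rewrite /nball/upto/=.
  have [<- _|/ndist_lb] := eqVneq None v; first by [].
  by case: v => [[[l j] []]|]//; rewrite /height/depth/=; lia.
Qed.

Lemma nball_upto u n : nball u n `<=` upto (stage u + n).
Proof.
move=> v; rewrite /nball/upto/=.
have [<- _|/ndist_lb] := eqVneq u v; first by lia.
by case: v u => [[[l j] []]|] [[[k i] []]|]//; rewrite /height/depth/=; lia.
Qed.

End geometry.

(** * The measure and the maximal function *)

(* [growth_mass] makes the inner atoms of stage [k] carry the level [1 / D k] of
   size [b k] in [L^{p,r}]; [growth_fast] lets stage [k.+1] outweigh the sum over
   the stages up to [k]. *)
Record growth {R : realType} (p : R) (b : nat -> R) (N : nat -> nat)
    (D m : nat -> R) : Prop := Growth {
  growth_D0 : D 0%N = 1;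
  growth_D_ge1 : forall k, 1 <= D k;
  growth_N_gt0 : forall k, (0 < N k)%N;
  growth_m_gt0 : forall k, 0 < m k;
  growth_m_le : forall k, m k <= D k;
  growth_mass : forall k, (N k)%:R * m k = (b k * D k) `^ p;
  growth_double : forall k, 2 * (b k * D k) `^ p <= (b k.+1 * D k.+1) `^ p;
  growth_D6 : forall k, 6 * D k <= D k.+1;
  growth_fast : forall k,
    7 * 2 ^+ k * ((N k)%:R * D k) ^+ 2 <= D k.+1 `^ p^-1 }.

Section space.
Context {R : realType} (p : R) (b : nat -> R) (N : nat -> nat) (D m : nat -> R).
Context (p1 : 1 <= p) (gr : growth p b N D m).
Local Notation T := (vertex N).
Implicit Types (u v : T) (k K : nat) (A B : set T).

Definition wt u : R :=
  if u is Some (existT k _, x) then (if x then m k else D k) else 1.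

(* The absolute value only serves to obtain a [{nonneg R}] without a proof. *)
Definition space_measure : {measure set T -> \bar R} :=
  weighted (fun u => `|wt u|%:nng).
Local Notation mu := space_measure.
Definition size_outer k : R := (N k)%:R * D k.
Definition size_inner k : R := (N k)%:R * m k.
Local Notation a := size_outer.

Let p0 : 0 < p. Proof. exact: lt_le_trans p1. Qed.
Let pV0 : 0 <= p^-1. Proof. by rewrite invr_ge0 ltW. Qed.
Let D1 k : 1 <= D k. Proof. exact: growth_D_ge1 gr k. Qed.
Let Dgt0 k : 0 < D k. Proof. exact: lt_le_trans (D1 k). Qed.
Let m0 k : 0 < m k. Proof. exact: growth_m_gt0 gr k. Qed.
Let mD k : m k <= D k. Proof. exact: growth_m_le gr k. Qed.
Let N1 k : 1 <= (N k)%:R :> R.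
Proof. by rewrite ler1n; exact: growth_N_gt0 gr k. Qed.

Lemma wt_gt0 u : 0 < wt u.
Proof. by case: u => [[[k i] []]|]/=. Qed.

Lemma wt_mE u : ((`|wt u|%:nng : {nonneg R})%:num)%R%:E = (wt u)%:E.
Proof. by congr EFin => /=; rewrite ger0_norm// ltW// wt_gt0. Qed.

Lemma measurable_all A : measurable A. Proof. by []. Qed.

Lemma measurable_fun_all dS (S : measurableType dS) A (f : T -> S) : measurable_fun A f.
Proof. by move=> _ B _; exact: measurable_all. Qed.

Lemma le_mu A B : A `<=` B -> (mu A <= mu B)%E.
Proof. by move=> AB; apply: le_measure; rewrite ?inE. Qed.

Lemma mu_setU A B : (mu (A `|` B) <= mu A + mu B)%E.
Proof. exact: measureU2. Qed.

Lemma mu_set1 u : mu [set u] = (wt u)%:E.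
Proof. by rewrite [LHS]weighted1 wt_mE. Qed.

Lemma esum_cst_ord n (c : R) : 0 <= c ->
  \esum_(i in [set: 'I_n]) c%:E = (n%:R * c)%:E.
Proof.
move=> c0; rewrite esum_fset//; last exact: finite_finset.
rewrite (_ : [set: 'I_n] = [set` enum 'I_n]); last first.
  by apply/seteqP; split=> i //= _; rewrite mem_enum.
rewrite -fsbig_seq ?enum_uniq// big_enum/= sumEFin; congr EFin.
by rewrite sumr_const card_ord mulr_natl.
Qed.

Lemma inner_inj k : injective (@inner N k).
Proof. by move=> i j [] /eqP; rewrite (@eq_Tagged _ (fun k => 'I_(N k)) (Tagged _ i)) => /eqP. Qed.

Lemma outer_inj k : injective (@outer N k).
Proof. by move=> i j [] /eqP; rewrite (@eq_Tagged _ (fun k => 'I_(N k)) (Tagged _ i)) => /eqP. Qed.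

Lemma mu_inners k : mu (inners k) = (size_inner k)%:E.
Proof.
rewrite (_ : inners k = (@inner N k) @` setT); last first.
  apply/seteqP; split=> [[[[l i] []]|] [//= _ <-]|_ [i _ <-]//].
  by exists i.
rewrite [LHS]esum_image; last by move=> i j _ _; exact: inner_inj.
under eq_esum do rewrite wt_mE.
by rewrite esum_cst_ord// ltW.
Qed.

Lemma mu_outers k : mu (outers k) = (size_outer k)%:E.
Proof.
rewrite (_ : outers k = (@outer N k) @` setT); last first.
  apply/seteqP; split=> [[[[l i] []]|] [//= _ <-]|_ [i _ <-]//].
  by exists i.
rewrite [LHS]esum_image; last by move=> i j _ _; exact: outer_inj.
under eq_esum do rewrite wt_mE.
by rewrite esum_cst_ord// ltW.
Qed.

Lemma size_outer_ge k : D k <= a k.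
Proof. by rewrite /size_outer ler_peMl// ltW. Qed.

Lemma size_outer_ge1 k : 1 <= a k.
Proof. exact: le_trans (size_outer_ge k). Qed.

Lemma size_inner_le k : size_inner k <= a k.
Proof. by rewrite /size_outer /size_inner ler_wpM2l. Qed.

Lemma root_le (x : R) : 1 <= x -> x `^ p^-1 <= x.
Proof. by move=> x1; rewrite ler1_powR// invf_le1. Qed.

Lemma fast k : 7 * 2 ^+ k * a k ^+ 2 <= D k.+1 `^ p^-1.
Proof. exact: growth_fast gr k. Qed.

Lemma size_outer_double k : 2 * a k <= a k.+1.
Proof.
apply: le_trans (size_outer_ge k.+1).
apply: le_trans (root_le _ (D1 _)); apply: le_trans (fast k).
have two : 1 <= 2 ^+ k :> R by rewrite exprn_ege1// ler1n.
by have := size_outer_ge1 k; nra.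
Qed.

Lemma upto0 : (upto 0%N : set T) `<=` [set None] `|` (inners 0%N `|` outers 0%N).
Proof.
move=> [[[k i] []]|]; rewrite /upto/= ?leqn0 => /eqP k0; last by left.
- by right; left.
- by right; right.
Qed.

Lemma uptoS K : (upto K.+1 : set T) `<=` upto K `|` (inners K.+1 `|` outers K.+1).
Proof.
move=> [[[k i] []]|]; rewrite /upto/=; last by left.
- by rewrite leq_eqVlt ltnS => /predU1P[kK|kK]; [right; left|left].
- by rewrite leq_eqVlt ltnS => /predU1P[kK|kK]; [right; right|left].
Qed.

(** One stage weighs at most [2 * a K], and [a] at least doubles: [5/2 + 2 <= 5]. *)
Lemma mu_upto K : (mu (upto K) <= (5 * a K)%:E)%E.
Proof.
have st k : (mu (inners k `|` outers k) <= (2 * a k)%:E)%E.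
  apply: (le_trans (mu_setU _ _)).
  rewrite mu_inners mu_outers.
  by rewrite -EFinD lee_fin; have := size_inner_le k; lra.
elim: K => [|K IH].
  apply: (le_trans (le_mu _ _ upto0)).
  apply: (le_trans (mu_setU _ _)).
  rewrite mu_set1.
  apply: (le_trans (leeD (le_refl _) (st 0%N))).
  by rewrite -EFinD lee_fin /=; have := size_outer_ge1 0%N; lra.
apply: (le_trans (le_mu _ _ (uptoS K))).
apply: (le_trans (mu_setU _ _)).
apply: (le_trans (leeD IH (st K.+1))).
by rewrite -EFinD lee_fin; have := size_outer_double K; have := size_outer_ge1 K; lra.
Qed.

Lemma size_inner_double k : 2 * size_inner k <= size_inner k.+1.
Proof. by rewrite /size_inner !(growth_mass _ _ _ _ _ gr); exact: growth_double gr k. Qed.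

Lemma mu_upto_inner K : (mu (upto K `&` [set u | is_inner u]) <= (2 * size_inner K)%:E)%E.
Proof.
elim: K => [|K IH].
  apply: (@le_trans _ _ (mu (inners 0%N))).
    by apply: le_mu => u [/upto0[->//|[//|[]]]]/=; case: u => [[[k i] []]|].
  rewrite mu_inners lee_fin.
  have : 0 <= size_inner 0%N by rewrite mulr_ge0// ltW.
  by lra.
apply: (@le_trans _ _ (mu ((upto K `&` [set u | is_inner u]) `|` inners K.+1))).
  by apply: le_mu => u [/uptoS[|[|[]]] h hX]; [left|right|move: h hX; case: u => [[[k i] []]|]].
apply: (le_trans (mu_setU _ _)).
rewrite mu_inners.
apply: (le_trans (leeD IH (le_refl _))).
by rewrite -EFinD lee_fin; have := size_inner_double K; lra.
Qed.

Definition mass (f : T -> R) A : \bar R := (\int[mu]_(u in A) `|f u|%:E)%E.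

Lemma mass_ge0 f A : (0 <= mass f A)%E.
Proof. by apply: integral_ge0 => u _; rewrite lee_fin. Qed.

Lemma le_mass f A B : A `<=` B -> (mass f A <= mass f B)%E.
Proof. by move=> AB; apply: ge0_subset_integral => // u _; rewrite lee_fin. Qed.

Lemma massU f A B : (mass f (A `|` B) <= mass f A + mass f B)%E.
Proof.
have f0 u : (0 <= `|f u|%:E)%E by rewrite lee_fin.
rewrite {1}/mass -(setDUK (@subsetUl _ A B)) ge0_integral_setU//; last first.
  by rewrite disj_set2E setDIK.
by rewrite leeD2l//; apply: le_mass => u [[]].
Qed.

Lemma mass_bound f A (c : R) : (forall u, A u -> `|f u| <= c) ->
  (mass f A <= c%:E * mu A)%E.
Proof.
move=> fc; rewrite -integral_cst//; exact: ge0_le_integral.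
Qed.

Lemma average_le (X : \bar R) (M : \bar R) (c : R) : (0 < M)%E -> (M < +oo)%E ->
  (X <= c%:E * M)%E -> (X * ((fine M)^-1)%:E <= c%:E)%E.
Proof.
case: M => [M| |]//; rewrite lte_fin => M0 _ XM.
have MV : (0 <= (M^-1)%:E)%E by rewrite lee_fin invr_ge0 ltW.
apply: (le_trans (lee_wpmul2r MV XM)).
by rewrite -muleA -EFinM lee_fin mulfV ?gt_eqF// mulr1.
Qed.

Lemma mu_fin A K : A `<=` upto K -> (mu A < +oo)%E.
Proof. by move=> AK; apply: le_lt_trans (le_mu _ _ AK) (le_lt_trans (mu_upto K) (ltry _)). Qed.

Lemma mu_gt0 u A : A u -> (0 < mu A)%E.
Proof.
move=> Au; apply: (@lt_le_trans _ _ (mu [set u])).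
  by rewrite mu_set1 lte_fin wt_gt0.
by apply: le_mu => _ ->.
Qed.

(** * Pointwise bound of the maximal function under a weak type bound on [f] *)

Section maximal_bound.
Context (f : T -> R) (L : R).
Context (L0 : 0 <= L) (fL : forall u, `|f u| <= L * (wt u `^ p^-1)^-1).

(** Bound, relative to [L], for averages over balls that reach exactly stage [k.+1]. The factor
    [1 / a k] outweighs the [p]-th root of the mass of [upto k], and [2 ^- k] remains for
    summability. *)
Definition decay k : R := (2 ^+ k * a k)^-1.

(** An atom of mass [x] carries at most [L * x^{1 - 1/p}], which is nondecreasing in [x]; hence the
    inner atoms carry no more than the bound for the outer ones. *)
Lemma mass_stage k :
  (mass f (inners k `|` outers k) <= (2 * L * (a k / D k `^ p^-1))%:E)%E.
Proof.
apply: (le_trans (massU _ _ _)).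
have I1 : (mass f (inners k) <= (L * (m k `^ p^-1)^-1)%:E * mu (inners k))%E.
  apply: mass_bound => u -[hX <-].
  by apply: (le_trans (fL u)); case: u hX => [[[l i] []]|].
have I2 : (mass f (outers k) <= (L * (D k `^ p^-1)^-1)%:E * mu (outers k))%E.
  apply: mass_bound => u -[hX <-].
  by apply: (le_trans (fL u)); case: u hX => [[[l i] []]|].
apply: (le_trans (leeD I1 I2)); rewrite mu_inners mu_outers -!EFinM -EFinD lee_fin.
rewrite /size_inner /size_outer.
have h : m k / m k `^ p^-1 <= D k / D k `^ p^-1.
  have q0 : 0 <= 1 - p^-1 by rewrite subr_ge0 invf_le1.
  have E x : 0 < x -> x / x `^ p^-1 = x `^ (1 - p^-1).
    move=> x0; rewrite powRB ?(gt_eqF x0) ?implybT//.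
    by rewrite powRr1// ltW.
  by rewrite !E// ge0_ler_powR// nnegrE ltW.
have NL : 0 <= L * (N k)%:R by rewrite mulr_ge0.
have := ler_wpM2l NL h.
rewrite (_ : L / m k `^ p^-1 * _ = L * (N k)%:R * (m k / m k `^ p^-1)); last by ring.
rewrite (_ : L / D k `^ p^-1 * _ = L * (N k)%:R * (D k / D k `^ p^-1)); last by ring.
rewrite (_ : 2 * L * _ = 2 * (L * (N k)%:R * (D k / D k `^ p^-1))); last by ring.
lra.
Qed.

Lemma mass_stage_le k :
  (mass f (inners k `|` outers k) <= (2 * L * a k)%:E)%E.
Proof.
apply: (le_trans (mass_stage k)); rewrite lee_fin ler_wpM2l ?mulr_ge0//.
have a0 : 0 <= a k by apply: le_trans (size_outer_ge1 k).
have y1 : 1 <= D k `^ p^-1 by rewrite -(powRr0 (D k)) ler_powR.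
by rewrite ler_pdivrMr ?(lt_le_trans _ y1)// ler_peMr.
Qed.

Lemma mass_upto0 : (mass f (upto 0%N) <= (3 * L * a 0%N)%:E)%E.
Proof.
apply: (le_trans (le_mass f _ _ upto0)); apply: (le_trans (massU _ _ _)).
have I0 : (mass f [set None] <= L%:E * mu [set None])%E.
  by apply: mass_bound => u ->; apply: (le_trans (fL _)); rewrite /= powR1 invr1 mulr1.
apply: (le_trans (leeD I0 (mass_stage_le 0%N))).
rewrite mu_set1 -EFinM -EFinD lee_fin /= mulr1.
by have := ler_wpM2l L0 (size_outer_ge1 0%N); have := L0; lra.
Qed.

Lemma mass_upto K : (mass f (upto K) <= (5 * L * a K)%:E)%E.
Proof.
elim: K => [|K IH].
  apply: (le_trans mass_upto0); rewrite lee_fin.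
  by have := ler_wpM2l L0 (size_outer_ge1 0%N); have := L0; lra.
apply: (le_trans (le_mass f _ _ (uptoS K))); apply: (le_trans (massU _ _ _)).
apply: (le_trans (leeD IH (mass_stage_le K.+1))).
rewrite -EFinD lee_fin.
have := ler_wpM2l L0 (size_outer_double K).
by have := ler_wpM2l L0 (size_outer_ge1 K.+1); have := L0; lra.
Qed.

(** The last stage gains [D K.+1 ^ (-1/p)] from [mass_stage], and the earlier ones are small against
    [a K.+1]. The constant 7 of [growth_fast] is the 5 of the earlier stages plus the 2 of the
    last. *)
Lemma mass_upto_decay K :
  (mass f (upto K.+1) <= (L * decay K * a K.+1)%:E)%E.
Proof.
apply: (le_trans (le_mass f _ _ (uptoS K))); apply: (le_trans (massU _ _ _)).
apply: (le_trans (leeD (mass_upto K) (mass_stage K.+1))).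
rewrite -EFinD lee_fin /decay.
set y := D K.+1 `^ p^-1.
have yD : y <= D K.+1 by exact: root_le.
have y0 : 0 < y by rewrite powR_gt0.
have yx := fast K; rewrite -/y in yx.
have xA := size_outer_ge K.+1.
set A1 := a K.+1 in xA *; set x := a K.
have x1 : 1 <= x := size_outer_ge1 K.
have t1 : 1 <= 2 ^+ K :> R by rewrite exprn_ege1// ler1n.
set t : R := 2 ^+ K in yx t1 *.
have A10 : 0 < A1 by apply: lt_le_trans xA; exact: Dgt0.
(* [5 x + 2 A1 / y <= 7 x A1 / y <= A1 / (t x)] *)
have h1 : 5 * L * x <= 5 * L * (x * (A1 / y)).
  rewrite ler_wpM2l ?mulr_ge0// ler_peMr//; first by lra.
  by rewrite ler_pdivlMr// mul1r; lra.
have h2 : 2 * L * (A1 / y) <= 2 * L * (x * (A1 / y)).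
  by rewrite ler_wpM2l ?mulr_ge0// ler_peMl// divr_ge0// ltW.
apply: (le_trans (lerD h1 h2)).
rewrite (_ : 5 * L * _ + 2 * L * _ = L * A1 * (7 * x / y)); last by ring.
rewrite (_ : L / (t * x) * A1 = L * A1 / (t * x)); last by ring.
rewrite ler_wpM2l//; first by rewrite mulr_ge0// ltW.
have tx0 : 0 < t * x by rewrite mulr_gt0//; lra.
rewrite ler_pdivrMr// [leRHS]mulrC ler_pdivlMr//.
by apply: le_trans yx; rewrite (_ : 7 * x * (t * x) = 7 * t * x ^+ 2)//; ring.
Qed.


Lemma size_outer_gt0 k : 0 < a k.
Proof. exact: lt_le_trans (size_outer_ge1 k). Qed.

Lemma decay_ge0 k : 0 <= decay k.
Proof. by rewrite /decay invr_ge0 mulr_ge0 ?exprn_ge0// ltW// size_outer_gt0. Qed.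

Lemma decay_antitone k K : (k <= K)%N -> decay K <= decay k.
Proof.
have P l : 0 < 2 ^+ l * a l.
  by rewrite mulr_gt0// ?exprn_gt0//; exact: lt_le_trans (size_outer_ge1 l).
elim: K => [|K IH]; first by rewrite leqn0 => /eqP->.
rewrite leq_eqVlt ltnS => /predU1P[->//|/IH]; apply: le_trans.
rewrite /decay lef_pV2 ?posrE// exprS.
have := size_outer_double K; have := size_outer_ge1 K.
have : 1 <= 2 ^+ K :> R by rewrite exprn_ege1// ler1n.
by move: (2 ^+ K) (a K) (a K.+1) => t x y; nra.
Qed.

Lemma decay_le_exp k : decay k <= (2 ^+ k)^-1.
Proof.
have e0 : 0 < 2 ^+ k :> R by rewrite exprn_gt0.
rewrite /decay lef_pV2 ?posrE ?(mulr_gt0 e0 (size_outer_gt0 k))//.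
by rewrite ler_peMr ?size_outer_ge1// ltW.
Qed.

(** Since [decay 0 = 1 / a 0], the value at the centre is 3, the bound for the average over its ball
    ending at stage 0. Elsewhere the factor [3 * a 0] is only at least 1. *)
Definition long_weight u : R := 3 * a 0%N * decay (stage u).
Lemma far_ge0 u : 0 <= long_weight u.
Proof. by rewrite /long_weight mulr_ge0 ?decay_ge0// mulr_ge0// ltW// size_outer_gt0. Qed.

Definition short_weight u : R := if is_inner u then (D (stage u))^-1 else 0.
Definition local_max u : R := Num.max `|f u| (if is_inner u then `|f (swap u)| else 0).

(** The ball contains the outer atoms of stage [K], so it has mass at least [a K], which cancels the
    same factor in the bound of its mass under [f]. *)
Lemma long_average u B K : long_ball u B K -> B u ->
  (mass f B * ((fine (mu B))^-1)%:E <= (L * long_weight u)%:E)%E.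
Proof.
move=> [uK KB BK] Bu; apply: average_le; [exact: mu_gt0 Bu|exact: mu_fin BK|].
have aB : ((a K)%:E <= mu B)%E by rewrite -mu_outers; exact: le_mu.
have a0 := size_outer_gt0.
have far0 := far_ge0 u.
apply: (@le_trans _ _ ((L * long_weight u)%:E * (a K)%:E)%E); last first.
  by apply: lee_wpmul2l => //; rewrite lee_fin mulr_ge0.
apply: (le_trans (le_mass f _ _ BK)); rewrite -EFinM.
case: K uK KB BK aB => [|K] uK KB BK aB.
  apply: (le_trans mass_upto0); rewrite lee_fin ler_wpM2r ?(ltW (a0 _))//.
  rewrite mulrC ler_wpM2l// /long_weight.
  case: u uK {Bu far0} => // _; rewrite /= /decay expr0 mul1r mulfK// gt_eqF//.
apply: (le_trans (mass_upto_decay K)); rewrite lee_fin.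
rewrite ler_wpM2r ?(ltW (a0 _))// ler_wpM2l//.
have uK' : (stage u <= K)%N by case: u uK {Bu far0}.
apply: (le_trans (decay_antitone _ _ uK')); rewrite /long_weight ler_peMl//.
  exact: decay_ge0.
by have := size_outer_ge1 0%N; lra.
Qed.

(** Each kind of ball in [nball_cases] is controlled by part of the sum. In a ball [{o, x, y}] the
    atoms [x] and [y] average to at most [local_max], while [o] has mass 1 and the ball has mass at
    least [D k] because of [y]. *)
Lemma maximal_le u : (cmaximal pdist mu f u <=
  (local_max u + `|f None| * short_weight u + L * long_weight u)%:E)%E.
Proof.
have loc0 : 0 <= local_max u by rewrite /local_max le_max normr_ge0.
have clo0 : 0 <= `|f None| * short_weight u.
  by rewrite mulr_ge0// /short_weight; case: ifP => // _; rewrite invr_ge0 ltW.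
have far0 : 0 <= L * long_weight u by rewrite mulr_ge0// far_ge0.
apply: ge_ereal_sup => _ [s /= s0 <-].
have [n ballE] := @oball_nball N R s s0.
rewrite ballE -/(mass f (nball u n)).
have Bu : nball u n u by rewrite /nball/= (ndist_eq0 u u).2.
have Bup := @nball_upto N u n.
case: (nball_cases u n) => [BE|[uX BE]|[K lb]].
- apply: (@le_trans _ _ (`|f u|)%:E).
    rewrite BE; apply: average_le; rewrite -?BE; [exact: mu_gt0 Bu|exact: mu_fin Bup|].
    by rewrite BE; apply: mass_bound => _ ->.
  rewrite lee_fin; have : `|f u| <= local_max u by rewrite /local_max le_max lexx.
  lra.
- apply: (@le_trans _ _ (local_max u + `|f None| * short_weight u)%:E); last first.
    by rewrite lee_fin; lra.
  apply: average_le; [exact: mu_gt0 Bu|exact: mu_fin Bup|].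
  have BE2 : nball u n = [set None] `|` ([set u] `|` [set swap u]).
    by rewrite BE setUA [[set None] `|` _]setUC.
  have loc1 : `|f u| <= local_max u by rewrite /local_max le_max lexx.
  have loc2 : `|f (swap u)| <= local_max u by rewrite /local_max uX le_max lexx orbT.
  have Dle : ((D (stage u))%:E <= mu (nball u n))%E.
    apply: (@le_trans _ _ (mu [set swap u])); last first.
      by apply: le_mu; rewrite BE2 => _ ->; right; right.
    rewrite mu_set1 lee_fin.
    by case: u uX {Bu Bup BE BE2 loc1 loc2 loc0 clo0 far0} => [[[k i] []]|].
  rewrite EFinD ge0_muleDl ?lee_fin//.
  rewrite [X in mass f X]BE2; apply: (le_trans (massU _ _ _)).
  rewrite addeC; apply: leeD.
    apply: (@le_trans _ _ ((local_max u)%:E * mu ([set u] `|` [set swap u]))%E).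
      by apply: mass_bound => _ [->|->].
    by apply: lee_wpmul2l; [rewrite lee_fin|apply: le_mu; rewrite BE2 => v; right].
  apply: (@le_trans _ _ (`|f None|%:E * mu [set None])%E).
    by apply: mass_bound => _ ->.
  rewrite mu_set1 /= mule1 /short_weight uX EFinM -muleA.
  rewrite -[leLHS]mule1; apply: lee_wpmul2l; first by rewrite lee_fin.
  rewrite -[leLHS](_ : ((D (stage u))^-1%:E * (D (stage u))%:E = 1)%E); last first.
    by rewrite -EFinM mulVf// gt_eqF.
  by apply: lee_wpmul2l => //; rewrite lee_fin invr_ge0 ltW.
- by apply: (le_trans (long_average _ _ _ lb Bu)); rewrite lee_fin; lra.
Qed.

End maximal_bound.

(** * The space is a metric measure space and is not doubling *)

Lemma oball1 u : oball (@pdist N R) u 1 = [set u].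
Proof.
apply/seteqP; split=> [v|v ->]; rewrite /oball/= /pdist ltrn1.
  by rewrite ltnS leqn0 => /eqP h; rewrite ((ndist_eq0 u v).1 h).
by rewrite (ndist_eq0 _ _).2.
Qed.

Lemma space_metric_measure : metric_measure_space (@pdist N R) mu.
Proof.
split; first by exists None.
split; first exact: pdist_metric.
split.
  (* Unit balls are singletons, so every set is open. *)
  apply/seteqP; split=> A _ //; apply: sub_gen_smallest => u Au.
  by exists 1 => //; rewrite oball1 => _ ->.
move=> u s s0; have [n ballE] := @oball_nball N R s s0.
rewrite ballE; split; last exact: mu_fin (@nball_upto N u n).
by apply: (@mu_gt0 u); rewrite /nball/= (ndist_eq0 u u).2.
Qed.

Lemma D_ge_exp k : 2 ^+ k <= D k.
Proof.
elim: k => [|k IH]; first by rewrite expr0.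
rewrite exprS; apply: le_trans (growth_D6 _ _ _ _ _ gr k).
by have := D1 k; lra.
Qed.

(** About an outer atom of stage [k] the ball of radius 1 is a singleton of mass [D k], whereas the
    ball of radius 2 contains all outer atoms of stage [k.+1], of mass at least [2 ^+ k * D k]. *)
Lemma space_not_doubling : ~ doubling (@pdist N R) mu.
Proof.
move=> [C dbl].
have key k : 2 ^+ k <= C.
  pose i : 'I_(N k) := Ordinal (growth_N_gt0 _ _ _ _ _ gr k).
  have := dbl (outer k i) 1 ltr01.
  rewrite oball1.
  have sub : outers k.+1 `<=` oball (@pdist N R) (outer k i) (2 * 1).
    move=> v [vY vk]; rewrite /oball/= /pdist mulr1 ltr_nat.
    apply: leq_ltn_trans (ndist_ub _ _) _.
    by move: vY vk; case: v => [[[l j] []]|]//= _ lk; rewrite /height/depth/=; lia.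
  move=> /(le_trans (le_mu _ _ sub)).
  rewrite mu_outers mu_set1 /= -EFinM lee_fin => h.
  have : 2 ^+ k * D k <= C * D k.
    apply: le_trans h; apply: le_trans (size_outer_ge _).
    apply: le_trans (root_le _ (D1 _)); apply: le_trans (fast k).
    have := size_outer_ge k; have := D1 k.
    have : 1 <= 2 ^+ k :> R by rewrite exprn_ege1// ler1n.
    move: (2 ^+ k) (D k) (a k) => t x y t1 x1 xy.
    have ty : x <= y ^+ 2 by nra.
    have tt : t * x <= t * y ^+ 2 by rewrite ler_wpM2l//; lra.
    by apply: (le_trans tt); rewrite -mulrA ler_peMl//; nra.
  by rewrite ler_pM2r.
have C0 : 0 <= C by apply: le_trans (key 0%N).
have := key (Num.truncn C).+1.
rewrite leNgt => /negP; apply.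
have := truncn_itv C0 => /andP[_ h]; apply: lt_le_trans h _.
by rewrite -natrX ler_nat; exact/ltnW/ltn_expl.
Qed.

Lemma distrib_dist_fun (g : T -> \bar R) : dist_fun (distrib mu g).
Proof.
split=> [t|s t st]; first exact: measure_ge0.
apply: le_mu => u /=; apply: le_lt_trans; rewrite lee_fin//.
Qed.

(* The outer atom of a pair is at least as heavy as the inner one. *)
Lemma mu_swap A : A `<=` [set u | is_inner u] -> (mu A <= mu (@swap N @` A))%E.
Proof.
move=> AX.
have -> : mu (@swap N @` A) =
    \esum_(u in A) ((`|wt (swap u)|%:nng : {nonneg R})%:num)%R%:E.
  by apply: esum_image => u v _ _ /(inv_inj (@swapK N)).
apply: le_esum => u /AX; rewrite !wt_mE lee_fin.
by case: u => [[[k i] []]|]//= _; exact: mD.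
Qed.

(** Geometric decay leaves finitely many indices above [t], so there is a last one; [c] itself need
    not be monotone. *)
Lemma last_above (c : nat -> R) (C t : R) : 0 < t -> (forall k, c k <= C / 2 ^+ k) ->
  (forall k, c k <= t) \/ exists k, t < c k /\ forall j, t < c j -> (j <= k)%N.
Proof.
move=> t0 cC.
have [ex|nex] := pselect (exists k, t < c k); last first.
  by left=> k; rewrite leNgt; apply/negP => tk; apply: nex; exists k.
right; have bd j : t < c j -> (j <= Num.truncn (C / t))%N.
  move=> tj; have h : t < C / 2 ^+ j by exact: lt_le_trans (cC j).
  have e0 : 0 < 2 ^+ j :> R by rewrite exprn_gt0.
  have h2 : 2 ^+ j < C / t by rewrite ltr_pdivlMr// mulrC -ltr_pdivlMr.
  rewrite truncn_ge_nat ?(ltW (lt_trans e0 h2))//.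
  apply: le_trans (ltW h2); rewrite -natrX ler_nat; exact/ltnW/ltn_expl.
have [k tk kmax] := ex_maxnP ex bd.
by exists k; split.
Qed.

Definition above (P : set T) (c : nat -> R) (t : R) : set T :=
  P `&` [set u | t < c (stage u)].

(** Brings a level set of a function of the stage into the alternative that [lor_step] asks for: it
    lies within [upto k] for the last index [k] above [t]. *)
Lemma stage_distribution (P : set T) (c S : nat -> R) (C t : R) : 0 < t ->
  (forall k, c k <= C / 2 ^+ k) -> (forall K, (mu (upto K `&` P) <= (S K)%:E)%E) ->
  mu (above P c t) = 0%E \/
  exists k, t < c k /\ (mu (above P c t) <= (S k)%:E)%E.
Proof.
move=> t0 cC PS; have [H|[k [tk kmax]]] := last_above c C t t0 cC.
  left; rewrite (_ : above P c t = set0) ?measure0//.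
  by apply/seteqP; split=> // u [_ /=]; rewrite ltNge H.
right; exists k; split=> //; apply: le_trans (PS k); apply: le_mu.
by move=> u [Pu /= tu]; split=> //; exact: kmax.
Qed.

Lemma stage_dist_fun (P : set T) (c : nat -> R) :
  dist_fun (fun t => mu (above P c t)).
Proof.
split=> [t|s t st]; first exact: measure_ge0.
by apply: le_mu => u [Pu /= tu]; split=> //=; exact: le_lt_trans tu.
Qed.

(** On atoms a weak type bound is a pointwise one, because the level set at any level below [|f u|]
    contains [u]. *)
Lemma weak_pointwise (f : T -> R) (M : R) :
  (lor p +oo (distrib mu (fun u => (f u)%:E)) <= M%:E)%E ->
  forall u, `|f u| <= M * (wt u `^ p^-1)^-1.
Proof.
move=> /lor_yP H u; rewrite leNgt; apply/negP => lt.
have w0 : 0 < wt u `^ p^-1 by rewrite powR_gt0// wt_gt0.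
set x := M * _ in lt.
have x0 : 0 <= x.
  have := H 1 ltr01; rewrite mul1e => /(le_trans (poweR_ge0 _ _)).
  by rewrite lee_fin => M0; rewrite mulr_ge0// invr_ge0 ltW.
pose t := (x + `|f u|) / 2.
have t0 : 0 < t by rewrite /t; lra.
have tf : t < `|f u| by rewrite /t; lra.
have : ((t * wt u `^ p^-1)%:E <= M%:E)%E.
  apply: le_trans (H t t0); rewrite EFinM; apply: lee_wpmul2l.
    by rewrite lee_fin ltW.
  change (poweR (wt u)%:E p^-1 <=
    poweR (distrib mu (fun u => (f u)%:E) t) p^-1)%E.
  apply: ge0_le_poweR => //; first by rewrite lee_fin ltW// wt_gt0.
  by rewrite -mu_set1; apply: le_mu => _ ->; rewrite /= lte_fin.
by rewrite lee_fin -ler_pdivlMr// -/x /t; lra.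
Qed.

(** * The constant is finite exactly when [b] is in [l^r] *)

Section constants.
Context (b0 : forall k, 0 < b k) (q r : \bar R).
Context (q1 : (1 <= q)%E) (r1 : (1 <= r)%E).

Lemma size_inner_gt0 k : 0 < size_inner k.
Proof. by rewrite mulr_gt0// (lt_le_trans ltr01). Qed.

(** This identity makes the level [1 / D k] on the inner atoms of stage [k] have size exactly
    [b k]. *)
Lemma size_inner_root k : size_inner k `^ p^-1 = b k * D k.
Proof.
rewrite /size_inner (growth_mass _ _ _ _ _ gr) -powRrM mulfV ?gt_eqF// powRr1//.
by rewrite mulr_ge0// ltW.
Qed.

Lemma root2_le (c x : R) : 1 <= c -> 0 <= x -> (c * x) `^ p^-1 <= c * x `^ p^-1.
Proof.
move=> c1 x0; rewrite powRM//; last by lra.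
by rewrite ler_wpM2r ?powR_ge0// root_le.
Qed.

(** The 4 anticipates the level [t/4] in [maximal_distribution], the 2 is that of [mu_upto_inner];
    up to these constants the terms are the [b k]. *)
Lemma close_fin : fin_seq r b ->
  fin_seq r (fun k => 4 / D k * (2 * size_inner k) `^ p^-1).
Proof.
apply: (@le_fin_seq _ _ _ _ 8) => // k; [|exact: ltW|].
  by rewrite mulr_ge0 ?powR_ge0// divr_ge0// ltW.
apply: (@le_trans _ _ (4 / D k * (2 * (b k * D k)))).
  rewrite ler_wpM2l ?divr_ge0 ?(ltW (Dgt0 k))// -size_inner_root.
  by rewrite root2_le ?ler1n// ltW// size_inner_gt0.
by rewrite le_eqVlt; apply/orP; left; apply/eqP; field; rewrite gt_eqF.
Qed.

(** Bounding the root of [5 * a k] by [5 * a k] itself cancels the [a k] in [decay], and a geometric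
    sequence is left, whatever [b] is. *)
Lemma far_fin : fin_seq r (fun k => 4 * (3 * a 0%N * decay k) * (5 * a k) `^ p^-1).
Proof.
apply: (le_fin_seq _ _ _ (60 * a 0%N) r1 _ _ _ _ (fin_seq_geometric _ r1)).
- by rewrite mulr_ge0// ltW// size_outer_gt0.
- move=> k; rewrite mulr_ge0 ?powR_ge0//.
  by rewrite mulr_ge0// mulr_ge0 ?decay_ge0// mulr_ge0// ltW// size_outer_gt0.
- by move=> k; rewrite invr_ge0 exprn_ge0.
move=> k; have ak := size_outer_gt0 k; have a00 := size_outer_gt0 0%N.
apply: (@le_trans _ _ (4 * (3 * a 0%N * decay k) * (5 * a k))).
  rewrite ler_wpM2l//.
    by rewrite mulr_ge0// mulr_ge0 ?decay_ge0// mulr_ge0// ltW.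
  by rewrite root_le//; have := size_outer_ge1 k; lra.
have e0 : 0 < 2 ^+ k :> R by rewrite exprn_gt0.
rewrite le_eqVlt; apply/orP; left; apply/eqP; rewrite /decay; field.
by rewrite !gt_eqF.
Qed.

Lemma cmaximal_ge0 (f : T -> R) u : (0 <= cmaximal pdist mu f u)%E.
Proof.
apply: le_trans (ereal_sup_ubound _); last by exists 1 => //=.
rewrite mule_ge0 ?mass_ge0// lee_fin invr_ge0 fine_ge0//; exact: measure_ge0.
Qed.

(** The level [t] is shared as [t/2 + t/4 + t/4] among the three terms of [maximal_le]. The centre
    has mass 1, so [|f None| <= L], and the last two terms become level sets of functions of the
    stage. *)
Lemma maximal_distribution (f : T -> R) (L t : R) (d : R -> \bar R) : 0 <= L ->
  (forall u, `|f u| <= L * (wt u `^ p^-1)^-1) -> 0 < t ->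
  d = distrib mu (fun u => (f u)%:E) ->
  (distrib mu (cmaximal pdist mu f) t <=
   (d (t / 2)%R + d (t / 2)%R) +
   (mu (above [set u | is_inner u] (fun k => (L * (4 / D k))%R) t) +
    mu (above setT (fun k => (L * (4 * (3 * a 0%N * decay k)))%R) t)))%E.
Proof.
move=> L0 fL t0 dE.
(* [A1] and [A2] cover the two entries of [local_max]; [A2] is carried to the outer partners, where
   [f] itself exceeds [t/2]. *)
pose A1 : set T := [set u | t / 2 < `|f u|].
pose A2 : set T := [set u | is_inner u /\ t / 2 < `|f (swap u)|].
set A3 := above _ _ t; set A4 := above _ _ t.
have A2d : (mu A2 <= d (t / 2)%R)%E.
  apply: le_trans (mu_swap A2 _) _; first by move=> u [].
  by rewrite dE; apply: le_mu => _ [u [_ h] <-]; rewrite /= lte_fin.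
have sub : [set u | (t%:E < `|cmaximal pdist mu f u|)%E] `<=` (A1 `|` A2) `|` (A3 `|` A4).
  move=> u /=; rewrite gee0_abs; last exact: cmaximal_ge0.
  move=> h; apply: contrapT => nh.
  have nA1 : `|f u| <= t / 2 by rewrite leNgt; apply/negP => x; apply: nh; left; left.
  have nA2 : is_inner u -> `|f (swap u)| <= t / 2.
    by move=> uX; rewrite leNgt; apply/negP => x; apply: nh; left; right.
  have nA3 : is_inner u -> L * (4 / D (stage u)) <= t.
    by move=> uX; rewrite leNgt; apply/negP => x; apply: nh; right; left.
  have nA4 : L * (4 * long_weight u) <= t.
    by rewrite leNgt; apply/negP => x; apply: nh; right; right.
  have := lt_le_trans h (maximal_le f L L0 fL u); rewrite lte_fin ltNge => /negP; apply.
  have fO : `|f None| <= L by apply: le_trans (fL _) _; rewrite /= powR1 invr1 mulr1.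
  have loc : local_max f u <= t / 2.
    rewrite /local_max ge_max nA1/=; case: ifP => [/nA2//|_].
    by rewrite divr_ge0// ltW.
  have clo : `|f None| * short_weight u <= t / 4.
    rewrite /short_weight; case: ifP => [/nA3|_]; last by rewrite mulr0 divr_ge0// ltW.
    have DV : 0 <= (D (stage u))^-1 by rewrite invr_ge0 ltW.
    by have := ler_wpM2r DV fO; move: (_ ^-1) => y; lra.
  lra.
apply: (le_trans (le_mu _ _ sub)); apply: (le_trans (mu_setU _ _)).
apply: leeD; apply: (le_trans (mu_setU _ _)); last exact: le_refl.
by apply: leeD => //; rewrite dE; apply: le_mu => u h; rewrite /= lte_fin.
Qed.

Lemma cmax_const_lty : (q <= r)%E -> fin_seq r b ->
  (cmax_const (@pdist N R) mu p q r < +oo)%E.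
Proof.
move=> qr hb.
have c10 k : 0 <= 4 / D k by rewrite divr_ge0// ltW.
have T10 k : 0 <= 2 * size_inner k by rewrite mulr_ge0// ltW// size_inner_gt0.
have c20 k : 0 <= 4 * (3 * a 0%N * decay k).
  by rewrite mulr_ge0// mulr_ge0 ?decay_ge0// mulr_ge0// ltW// size_outer_gt0.
have T20 k : 0 <= 5 * a k by rewrite mulr_ge0// ltW// size_outer_gt0.
have [K1 K10 H1] := lor_step p r _ _ p1 r1 c10 T10 (close_fin hb).
have [K2 K20 H2] := lor_step p r _ _ p1 r1 c20 T20 far_fin.
(* Two nested uses of [lorD] give 16. The bracket times [M] dominates [8 * M] from embedding and
   dilation, and [4 * K1 * M] and [4 * K2 * M] from the two step functions. *)
pose c : R := 16 * (32 + 4 * K1 + 4 * K2).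
apply: (@le_lt_trans _ _ c%:E); last exact: ltry.
apply: ereal_inf_lbound; exists c => //; split; first by rewrite /c; lra.
move=> f _; rewrite !lorentzE.
set d := distrib mu (fun u => (f u)%:E) => dfin.
have dd : dist_fun d := distrib_dist_fun _.
have [M ME] : exists M, lor p q d = M%:E.
  exists (fine (lor p q d)); rewrite fineK// ge0_fin_numE//.
  by apply: lor_ge0; exact: ltW.
have M0 : 0 <= M by rewrite -lee_fin -ME; apply: lor_ge0; exact: ltW.
have dM : (lor p q d <= M%:E)%E by rewrite ME.
rewrite ME -EFinM.
have L0 : 0 <= 4 * M by rewrite mulr_ge0.
have fL := weak_pointwise f (4 * M) (lor_embed _ _ _ _ _ p1 q1 (leey _) M0 dd dM).
have dr := lor_half _ _ _ _ p1 r1 L0 dd (lor_embed _ _ _ _ _ p1 q1 qr M0 dd dM).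
pose B := (32 + 4 * K1 + 4 * K2) * M.
have B0 : 0 <= B by rewrite /B mulr_ge0//; lra.
have K1M : 0 <= K1 * M by rewrite mulr_ge0.
have K2M : 0 <= K2 * M by rewrite mulr_ge0.
pose d1 t := mu (above [set u | is_inner u] (fun k => (4 * M) * (4 / D k)) t).
pose d2 t := mu (above setT (fun k => (4 * M) * (4 * (3 * a 0%N * decay k))) t).
have dd1 : dist_fun d1 by exact: stage_dist_fun.
have dd2 : dist_fun d2 by exact: stage_dist_fun.
have h1 : (lor p r d1 <= B%:E)%E.
  apply: (@le_trans _ _ (K1 * (4 * M))%:E); last by rewrite lee_fin /B; lra.
  apply: H1 => // t t0.
  apply: (stage_distribution _ _ _ (4 * M * 4)) => // [k|K]; last exact: mu_upto_inner.
  rewrite mulrA ler_wpM2l ?mulr_ge0// lef_pV2 ?posrE ?exprn_gt0//.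
  exact: D_ge_exp.
have h2 : (lor p r d2 <= B%:E)%E.
  apply: (@le_trans _ _ (K2 * (4 * M))%:E); last by rewrite lee_fin /B; lra.
  apply: H2 => // t t0.
  apply: (stage_distribution _ _ _ (4 * M * (4 * (3 * a 0%N)))) => // [k|K].
    have a00 := ltW (size_outer_gt0 0%N).
    rewrite (_ : 4 * M * _ = 4 * M * (4 * (3 * a 0%N)) * decay k); last by ring.
    rewrite ler_wpM2l ?decay_le_exp//.
    by move: (a 0%N) a00 => z z0; rewrite !mulr_ge0.
  by rewrite setIT; exact: mu_upto.
have h3 : (lor p r (fun t => d (t / 2)%R) <= B%:E)%E.
  by apply: (le_trans dr); rewrite lee_fin /B; lra.
have dh : dist_fun (fun t => d (t / 2)) by exact: dist_fun_half.
have s1 := lorD p r _ _ _ p1 r1 B0 dh dh h3 h3.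
have s2 := lorD p r _ _ _ p1 r1 B0 dd1 dd2 h1 h2.
have B40 : 0 <= 4 * B by rewrite mulr_ge0.
have s3 := lorD p r _ _ _ p1 r1 B40 (dist_funD _ _ dh dh) (dist_funD _ _ dd1 dd2) s1 s2.
rewrite (_ : c * M = 4 * (4 * B)); last by rewrite /c /B; ring.
apply: le_trans s3; apply: le_lor => //.
- by apply: lt_le_trans r1.
- exact: distrib_dist_fun.
- exact: (dist_funD _ _ (dist_funD _ _ dh dh) (dist_funD _ _ dd1 dd2)).
- by move=> t t0; exact: maximal_distribution.
Qed.

Definition spike u : R := (u == None)%:R.

Lemma norm_spike u : `|spike u| = (u == None)%:R.
Proof. by rewrite /spike normr_nat. Qed.

(** The indicator of the centre is a step function with the single level 1 on mass 1, so [lor_step]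
    replaces an explicit integral. *)
Lemma lorentz_spike : (lorentz mu p q (fun u => (spike u)%:E) < +oo)%E.
Proof.
rewrite lorentzE; pose c k : R := (k == 0%N)%:R.
have c0 k : 0 <= c k by [].
have hc : fin_seq q (fun k => c k * 1 `^ p^-1).
  apply: (le_fin_seq _ _ _ 1 q1 _ _ _ _ (fin_seq_geometric _ q1)) => // k.
  - by rewrite powR1 mulr1.
  - rewrite powR1 mulr1 mul1r /c; case: k => [|k]; first by rewrite expr0 invr1.
    by rewrite /= invr_ge0 exprn_ge0.
have [K K0 H] := lor_step p q c (fun=> 1) p1 q1 c0 (fun=> ler01) hc.
apply: le_lt_trans (H 1 _ ler01 (distrib_dist_fun _) _) (ltry _) => t t0.
have [t1|t1] := ltP t 1.
  right; exists 0%N; rewrite /c mul1r; split=> //.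
  rewrite -[1%:E]/((wt None)%:E) -mu_set1; apply: le_mu => u /=.
  rewrite lte_fin norm_spike; case: eqP => // _.
  by rewrite ltNge (ltW t0).
left; rewrite /distrib (_ : [set u | _] = set0) ?measure0//.
apply/seteqP; split=> // u /=; rewrite lte_fin norm_spike.
by case: eqP => _; rewrite ltNge ?t1// (ltW t0).
Qed.

Lemma maximal_spike k u : inners k u ->
  (((1 + m k + D k)^-1)%:E <= cmaximal pdist mu spike u)%E.
Proof.
(* A radius strictly between [k + 1] and [k + 2] selects the ball [{o, x, y}]. *)
move=> [uX uk]; pose s : R := k.+1%:R + 2^-1.
have s0 : 0 < s by rewrite /s ltr_wpDl.
have ballE : oball (@pdist N R) u s = [set u; None; swap u].
  rewrite -(nball_short u uX) uk; apply/seteqP; split=> v.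
    rewrite /oball/nball/= /pdist => h; rewrite leqNgt; apply/negP => k2.
    have : k.+2%:R <= (ndist u v)%:R :> R by rewrite ler_nat.
    by move: h; rewrite /s -(natr1 k.+1); lra.
  rewrite /oball/nball/= /pdist => h; apply: (@le_lt_trans _ _ k.+1%:R).
    by rewrite ler_nat.
  by rewrite /s; lra.
apply: le_trans (ereal_sup_ubound _); last by exists s => //; reflexivity.
rewrite ballE -/(mass spike _).
set B := (X in mass _ X).
have Bfin : (mu B < +oo)%E by rewrite /B -(nball_short u uX); exact: mu_fin (@nball_upto N u _).
have B0 : (0 < mu B)%E by apply: (@mu_gt0 u); left; left.
have BE : (fine (mu B))%:E = mu B by rewrite fineK// ge0_fin_numE// ltW.
have Ble : fine (mu B) <= 1 + m k + D k.
  rewrite -lee_fin BE; apply: (le_trans (mu_setU _ _)).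
  apply: (le_trans (leeD (mu_setU _ _) (le_refl _))).
  rewrite !mu_set1 -!EFinD lee_fin.
  by move: uX uk; case: u {B BE Bfin B0 ballE} => [[[l i] []]|]//= _ <-; lra.
have one : (1%:E <= mass spike B)%E.
  apply: (@le_trans _ _ (mass spike [set None])); last first.
    by apply: le_mass => _ ->; left; right.
  rewrite /mass (eq_integral (cst 1%:E)); last first.
    by move=> v; rewrite inE => ->; rewrite norm_spike eqxx.
  by rewrite integral_cst// mul1e mu_set1.
have fB0 : 0 < fine (mu B) by rewrite -lte_fin BE.
apply: (@le_trans _ _ (1%:E * ((fine (mu B))^-1)%:E)%E).
  rewrite mul1e lee_fin lef_pV2 ?posrE//.
  by apply: lt_le_trans Ble.
by apply: lee_wpmul2r => //; rewrite lee_fin invr_ge0 ltW.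
Qed.

(** The maximal function of [spike] is at least [c k] on the inner atoms of stage [k], so it has
    infinite quasinorm while [spike] has a finite one. No constant is admissible, and the infimum of
    the empty set is [+oo]. *)
Lemma cmax_const_infty : ~ fin_seq r b ->
  cmax_const (@pdist N R) mu p q r = +oo%E.
Proof.
move=> nb; pose c k : R := (1 + m k + D k)^-1.
have s0 k : 0 < 1 + m k + D k by have := m0 k; have := Dgt0 k; lra.
have c0 k : 0 < c k by rewrite invr_gt0.
have big : lorentz mu p r (cmaximal pdist mu spike) = +oo%E.
  rewrite lorentzE; apply: (lor_step_infty p r c size_inner) => //.
  (* As [1 + m k + D k <= 3 * D k], halving needs a growth of [D] by the factor 6. *)
  - move=> k; rewrite /c -invfM lef_pV2 ?posrE ?mulr_gt0//.
    have := growth_D6 _ _ _ _ _ gr k; have := m0 k.+1; have := mD k; have := D1 k.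
    lra.
  - by move=> k; exact/ltW/size_inner_gt0.
  - exact: distrib_dist_fun.
  - move=> k t t0 tc; rewrite -mu_inners; apply: le_mu => u /maximal_spike uk /=.
    rewrite gee0_abs; last exact: cmaximal_ge0.
    by apply: lt_le_trans uk; rewrite lte_fin.
  move=> h; apply: nb; move: h.
  apply: (le_fin_seq _ _ _ 3) => // k; first exact: ltW.
    by rewrite mulr_ge0 ?powR_ge0// ltW.
  rewrite size_inner_root /c.
  have h : (3 * D k)^-1 <= (1 + m k + D k)^-1.
    rewrite lef_pV2 ?posrE ?mulr_gt0//.
    by have := mD k; have := D1 k; lra.
  have bD : 0 <= b k * D k by rewrite mulr_ge0// ltW.
  have := ler_wpM2r bD h; rewrite (_ : (3 * D k)^-1 * (b k * D k) = b k / 3); last first.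
    by field; rewrite gt_eqF.
  lra.
apply/eqP; rewrite eq_le leey/=; apply: le_ereal_inf_tmp => _ [c' [c'0 H] <-].
have := H spike (measurable_fun_all _ _ _ _) lorentz_spike; rewrite big leye_eq => /eqP E.
have : (c'%:E * lorentz mu p q (fun u => (spike u)%:E) < +oo)%E.
  by rewrite lte_mul_pinfty// lorentz_spike.
by rewrite E.
Qed.

End constants.

End space.

(** * Choice of the parameters *)

(** [N k] is read off from [D k], and only then is [D k.+1] chosen, so the growth conditions can
    refer to [N k]. The masses [m k] are then forced by [growth_mass]. *)
Lemma growth_exists {R : realType} (p : R) (b : nat -> R) : 1 <= p ->
  (forall k, 0 < b k) -> exists N D m, growth p b N D m.
Proof.
move=> p1 b0.
have p0 : 0 < p by exact: lt_le_trans p1.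
have pV0 : 0 <= p^-1 by rewrite invr_ge0 ltW.
pose n k (x : R) := (Num.truncn ((b k * x) `^ p / x)).+1.
pose z k (x : R) := 7 * 2 ^+ k * ((n k x)%:R * x) ^+ 2.
pose next k x := z k x `^ p * (1 + 2 * (b k / b k.+1)).
pose D := fix D k := if k is k'.+1 then next k' (D k') else 1.
have n1 k x : 1 <= (n k x)%:R :> R by rewrite ler1n.
have zx k x : 1 <= x -> 7 * x <= z k x.
  move=> x1; rewrite /z; have t1 : 1 <= 2 ^+ k :> R by rewrite exprn_ege1// ler1n.
  move: (2 ^+ k) (n k x)%:R t1 (n1 k x) => t y t1 y1.
  have yx : x <= y * x by rewrite ler_peMl//; lra.
  have h : x <= (y * x) ^+ 2.
    by rewrite expr2; apply: (le_trans yx); rewrite ler_peMl//; lra.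
  by rewrite -mulrA ler_pM2l//; apply: (le_trans h); rewrite ler_peMl// sqr_ge0.
have zp k x : 1 <= x -> z k x <= z k x `^ p.
  by move=> x1; rewrite le1r_powR//; have := zx k x x1; lra.
have q0 k : 0 < b k / b k.+1 by rewrite divr_gt0.
have nextz k x : 1 <= x -> z k x `^ p <= next k x.
  by move=> x1; rewrite /next ler_peMr ?powR_ge0//; have := q0 k; lra.
have D1 k : 1 <= D k.
  elim: k => //= k IH; have := zx k _ IH; have := zp k _ IH; have := nextz k _ IH; lra.
have Dgt0 k : 0 < D k by exact: lt_le_trans (D1 k).
have bD k : 0 < b k * D k by rewrite mulr_gt0.
exists (fun k => n k (D k)), D, (fun k => (b k * D k) `^ p / (n k (D k))%:R).
split=> //.
- by move=> k; rewrite divr_gt0 ?powR_gt0// (lt_le_trans ltr01).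
- move=> k; rewrite ler_pdivrMr ?(lt_le_trans ltr01)// [leRHS]mulrC -ler_pdivrMr//.
  have X0 : 0 <= (b k * D k) `^ p / D k by rewrite divr_ge0 ?powR_ge0// ltW.
  by have /andP[_ /ltW] := truncn_itv X0.
- by move=> k; rewrite mulrC divfK// gt_eqF// (lt_le_trans ltr01).
- move=> k; have step : 2 * (b k * D k) <= b k.+1 * D k.+1.
    rewrite -ler_pdivrMl//= /next; have := zx k _ (D1 k); have := zp k _ (D1 k).
    move: (z k (D k)) => w wp Dw.
    rewrite (_ : (b k.+1)^-1 * _ = D k * (2 * (b k / b k.+1))); last by ring.
    apply: (@le_trans _ _ (w `^ p * (2 * (b k / b k.+1)))).
      rewrite ler_wpM2r//; first by rewrite mulr_ge0// ltW.
      by have := Dgt0 k; lra.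
    by rewrite ler_wpM2l ?powR_ge0//; lra.
  apply: (@le_trans _ _ ((2 * (b k * D k)) `^ p)).
    rewrite [leRHS]powRM ?(ltW (bD _))// ler_wpM2r ?powR_ge0//.
    by rewrite le1r_powR// ler1n.
  apply: ge0_ler_powR step; rewrite ?nnegrE; [exact: ltW| |exact/ltW/bD].
  by rewrite mulr_ge0// ltW.
- move=> k /=; have := zx k _ (D1 k); have := zp k _ (D1 k).
  by have := nextz k _ (D1 k); have := D1 k; lra.
- move=> k /=; apply: (@le_trans _ _ ((z k (D k) `^ p) `^ p^-1)).
    rewrite -powRrM mulfV ?gt_eqF// powRr1//.
    by have := zx k _ (D1 k); have := D1 k; lra.
  by apply: ge0_ler_powR; rewrite ?nnegrE ?powR_ge0 ?nextz// (le_trans _ (nextz _ _ _)) ?powR_ge0.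
Qed.

(** * Sequences with a prescribed summability threshold *)

Section series.
Context {R : realType}.
Implicit Types (x u b : nat -> R).

Lemma fin_seq_telescope x u (C : R) : 0 <= C -> (forall k, 0 <= x k) ->
  (forall k, 0 <= u k) -> (forall k, x k <= C * (u k - u k.+1)) ->
  fin_seq 1%E x.
Proof.
move=> C0 x0 u0 xu; apply: (@le_lt_trans _ _ (C * u 0%N)%:E); last exact: ltry.
apply: nneseries_le => [k|n]; first exact: powR_ge0.
apply: (@le_trans _ _ (C * (u 0%N - u n))); last first.
  by rewrite ler_wpM2l// gerBl.
elim: n => [|n IH]; first by rewrite big_geq// subrr mulr0.
rewrite big_nat_recr//= powRr1//; apply: (le_trans (lerD IH (xu n))).
by rewrite -mulrDr ler_wpM2l//; lra.
Qed.

Lemma harmonic_infinite : ~ fin_seq 1%E (fun k => (k.+1%:R)^-1 : R).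
Proof.
move=> h; apply: (@dvg_harmonic R).
have h0 k : 0 <= (k.+1%:R)^-1 :> R by rewrite invr_ge0.
rewrite /fin_seq in h; set S := (X in (X < _)%E) in h.
have S0 : (0 <= S)%E by apply: nneseries_ge0 => k _ _; rewrite lee_fin powR_ge0.
apply: nondecreasing_is_cvgn.
  apply/nondecreasing_seqP => n.
  by rewrite /series/= big_nat_recr//= lerDl.
exists (fine S) => _ [n _ <-]; rewrite -lee_fin fineK ?ge0_fin_numE//.
rewrite /series/= -sumEFin /S.
under eq_bigr do rewrite -[_^-1]powRr1//.
by apply: nneseries_lim_ge => k _ _; rewrite lee_fin powR_ge0.
Qed.

Lemma fin_seq_powR (r : R) b :
  fin_seq r%:E b <-> fin_seq 1%E (fun k => b k `^ r).
Proof.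
suff E : (\sum_(0 <= k <oo) ((b k `^ r) `^ 1)%:E =
          \sum_(0 <= k <oo) (b k `^ r)%:E)%E by rewrite /fin_seq E.
by apply: eq_eseriesr => k _; rewrite powRr1 ?powR_ge0.
Qed.

Lemma infinite_of_harmonic (r C : R) b : 1 <= r -> 0 <= C ->
  (forall k, (k.+1%:R)^-1 <= C * b k `^ r) -> ~ fin_seq r%:E b.
Proof.
move=> r1 C0 hb /fin_seq_powR fb; apply: harmonic_infinite.
by apply: (le_fin_seq _ _ _ C _ C0 _ _ hb fb) => // k; rewrite ?invr_ge0 ?powR_ge0.
Qed.

(** This is [ln (1 + x) <= x] at [x = - 1 / (k + 2)]. *)
Lemma ln_succ_ge (k : nat) : (k.+2%:R)^-1 <= ln k.+2%:R - ln k.+1%:R :> R.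
Proof.
have k1 : 0 < k.+1%:R :> R by [].
have k2 : 0 < k.+2%:R :> R by [].
have E : k.+1%:R / k.+2%:R = 1 + - (k.+2%:R)^-1 :> R.
  rewrite -[k.+2%:R]natr1; move: (k.+1%:R) k1 => y y0; field.
  by rewrite gt_eqF//; lra.
have : ln (k.+1%:R / k.+2%:R) <= - (k.+2%:R)^-1 :> R.
  by rewrite E; apply: le_ln1Dx; rewrite ltrN2 invf_lt1// ltr1n.
by rewrite ln_div ?posrE// -[in X in _ -> X]lerN2 opprB.
Qed.

(** Telescoping replaces the integral test: with [e = s - 1], the inequality [exp x >= 1 + x] gives
    [e (k+2)^{-s} <= (k+1)^{-e} - (k+2)^{-e}], and passing from [k + 2] to [k + 1] costs at most
    [2^s]. *)
Lemma power_finite (s : R) : 1 < s -> fin_seq 1%E (fun k => k.+1%:R `^ (- s)).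
Proof.
move=> s1; pose e := s - 1; have e0 : 0 < e by rewrite /e; lra.
apply: (@fin_seq_telescope _ (fun k => k.+1%:R `^ (- e)) (2 `^ s / e)).
- by rewrite divr_ge0 ?powR_ge0// ltW.
- by move=> k; exact: powR_ge0.
- by move=> k; exact: powR_ge0.
move=> k; have k1 : 0 < k.+1%:R :> R by [].
have k2 : 0 < k.+2%:R :> R by [].
have main : e * (k.+2%:R `^ (- s)) <= k.+1%:R `^ (- e) - k.+2%:R `^ (- e).
  have powE (y t : R) : 0 < y -> y `^ t = expR (t * ln y).
    by move=> y0; rewrite /powR gt_eqF.
  have -> : k.+1%:R `^ (- e) =
      k.+2%:R `^ (- e) * expR (e * (ln k.+2%:R - ln k.+1%:R)).
    by rewrite !powE// -expRD; congr expR; ring.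
  have -> : k.+2%:R `^ (- s) = k.+2%:R `^ (- e) * (k.+2%:R)^-1.
    rewrite -[X in _ * X]powR_inv1; last exact: ltW.
    rewrite -powRD; last by rewrite (gt_eqF k2) implybT.
    by congr powR; rewrite /e; ring.
  have h1 := ler_wpM2l (ltW e0) (ln_succ_ge k).
  have h2 := expR_ge1Dx (e * (ln k.+2%:R - ln k.+1%:R) : R).
  have P0 := powR_ge0 (k.+2%:R : R) (- e).
  have h3 := ler_wpM2l P0 (le_trans (lerD (lexx (1 : R)) h1) h2).
  rewrite lerBrDl; apply: le_trans h3.
  by rewrite mulrDr mulr1 lerD2l mulrCA.
have half : k.+1%:R `^ (- s) <= 2 `^ s * k.+2%:R `^ (- s).
  rewrite !powRN ler_pdivlMr ?powR_gt0// mulrC -ler_pdivlMr ?invr_gt0 ?powR_gt0//.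
  rewrite invrK -powRM// ge0_ler_powR ?nnegrE//; first by lra.
  by rewrite -natrM ler_nat mul2n -addnn addnS ltnS leq_addr.
apply: (le_trans half); rewrite -mulrA ler_wpM2l ?powR_ge0//.
by rewrite mulrC ler_pdivlMr// mulrC.
Qed.


(** Its successive differences are of order [1 / (k (ln k)^2)], a borderline series: it converges by
    telescoping, but no power of it with exponent below 1 does. *)
Definition lnseq k : R := (1 + ln k.+1%:R)^-1.

Lemma lnseq_gt0 k : 0 < 1 + ln k.+1%:R :> R.
Proof. by rewrite ltr_pwDl// ln_ge0// ler1n. Qed.

Lemma lnseq_diff k : lnseq k - lnseq k.+1 =
  (ln k.+2%:R - ln k.+1%:R) / ((1 + ln k.+1%:R) * (1 + ln k.+2%:R)).
Proof.
rewrite /lnseq; have := lnseq_gt0 k; have := lnseq_gt0 k.+1.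
by move=> h1 h2; field; rewrite !gt_eqF.
Qed.

Lemma ln_succ_gt0 k : 0 < ln k.+2%:R - ln k.+1%:R :> R.
Proof. by apply: lt_le_trans (ln_succ_ge k); rewrite invr_gt0. Qed.

Lemma lnseq_diff_gt0 k : 0 < lnseq k - lnseq k.+1.
Proof. by rewrite lnseq_diff divr_gt0 ?ln_succ_gt0// mulr_gt0// lnseq_gt0. Qed.

Lemma lnseq_diff_le1 k : lnseq k - lnseq k.+1 <= 1.
Proof.
have h : lnseq k <= 1.
  by rewrite /lnseq invf_le1 ?lnseq_gt0// lerDl ln_ge0// ler1n.
have : 0 <= lnseq k.+1 by rewrite /lnseq invr_ge0 ltW// lnseq_gt0.
lra.
Qed.

Lemma ln1_le_powR (e y : R) : 0 < e -> 1 <= y -> 1 + ln y <= (1 + e^-1) * y `^ e.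
Proof.
move=> e0 y1.
have y0 : 0 < y by exact: lt_le_trans y1.
have Y1 : 1 <= y `^ e by rewrite -(powRr0 y) ler_powR// ltW.
have h : e * ln y <= y `^ e.
  by rewrite -ln_powR; exact/ltW/ln_sublinear/(lt_le_trans ltr01).
have : ln y <= e^-1 * y `^ e.
  by rewrite -(ler_pM2l e0) mulrA mulfV ?gt_eqF// mul1r.
by rewrite mulrDl mul1r; lra.
Qed.

Lemma invr_powR (z t : R) : 0 <= z -> (z^-1) `^ t = (z `^ t)^-1.
Proof. by move=> z0; rewrite -powR_inv1// -powRrM mulN1r powRN. Qed.

Lemma lnseq_infinite (th : R) : 0 < th < 1 -> exists2 C : R, 0 <= C &
  forall k, (k.+1%:R)^-1 <= C * (lnseq k - lnseq k.+1) `^ th.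
Proof.
move=> /andP[th0 th1].
have [e e0 the] : exists2 e, 0 < e & th * (1 + 2 * e) = 1.
  exists ((th^-1 - 1) / 2); first by rewrite divr_gt0// subr_gt0 invf_gt1.
  by field; rewrite gt_eqF.
pose c := 1 + e^-1; have c0 : 0 < c by rewrite /c addr_gt0// invr_gt0.
exists (2 * (c ^+ 2) `^ th); first by rewrite mulr_ge0 ?powR_ge0.
move=> k; set y : R := k.+2%:R.
have y1 : 1 <= y by rewrite ler1n.
have y0 : 0 < y by exact: lt_le_trans y1.
have ye0 : 0 < y `^ e by rewrite powR_gt0.
have low : (y * (c * y `^ e) ^+ 2)^-1 <= lnseq k - lnseq k.+1.
  rewrite lnseq_diff invfM ler_pM ?invr_ge0 ?exprn_ge0 ?mulr_ge0 ?(ltW ye0) ?(ltW c0) ?(ltW y0)//.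
    exact: ln_succ_ge.
  have lk := lnseq_gt0 k; have lk1 := lnseq_gt0 k.+1.
  rewrite lef_pV2 ?posrE ?exprn_gt0 ?mulr_gt0// expr2.
  have hk := ln1_le_powR e y e0 y1.
  rewrite ler_pM ?(ltW lk) ?(ltW lk1)//; apply: le_trans hk.
  by rewrite lerD2l ler_ln ?posrE// ler_nat.
have ZE : y * (c * y `^ e) ^+ 2 = c ^+ 2 * y `^ (1 + 2 * e).
  rewrite exprMn powRD; last by rewrite (gt_eqF y0) implybT.
  by rewrite powRr1 ?(ltW y0)// [2 * e]mulrC powRrM powR_mulrn ?(ltW ye0)//; ring.
have Zth : (y * (c * y `^ e) ^+ 2) `^ th = (c ^+ 2) `^ th * y.
  rewrite ZE powRM ?powR_ge0 ?exprn_ge0 ?(ltW c0)// -powRrM [_ * th]mulrC the.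
  by rewrite powRr1// ltW.
have Z0 : 0 < y * (c * y `^ e) ^+ 2 by rewrite mulr_gt0// exprn_gt0// mulr_gt0.
have low2 : ((c ^+ 2) `^ th * y)^-1 <= (lnseq k - lnseq k.+1) `^ th.
  rewrite -Zth -invr_powR ?(ltW Z0)//.
  apply: ge0_ler_powR low; rewrite ?nnegrE ?(ltW th0) ?(ltW (lnseq_diff_gt0 _))//.
  by rewrite invr_ge0 ltW.
have C0 : 0 < (c ^+ 2) `^ th by rewrite powR_gt0// exprn_gt0.
apply: (@le_trans _ _ (2 * (c ^+ 2) `^ th * ((c ^+ 2) `^ th * y)^-1)); last first.
  by rewrite ler_wpM2l// mulr_ge0// ltW.
rewrite (_ : 2 * _ * _ = 2 / y); last by field; rewrite !gt_eqF.
rewrite ler_pdivlMr// mulrC ler_pdivrMr//.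
by rewrite -natrM ler_nat mul2n -addnn addnS ltnS leq_addr.
Qed.


(* The witness is [(k + 1) ^ (-1 / r0)], and [k + 1] if [r0 = +oo]. *)
Lemma threshold_closed (r0 : \bar R) : (1 <= r0)%E -> exists b : nat -> R,
  [/\ forall k, 0 < b k,
      forall r, (1 <= r)%E -> (r <= r0)%E -> ~ fin_seq r b &
      forall r, (r0 < r)%E -> fin_seq r b].
Proof.
case: r0 => [r0| |//] r01; last first.
  exists (fun k => k.+1%:R); split=> [k//| |r]; last by case: r.
  case=> [r r1 _|_ _ [B h]|//].
    apply: (infinite_of_harmonic r 1) => // k.
    rewrite mul1r; apply: (@le_trans _ _ 1); first by rewrite invf_le1// ler1n.
    rewrite -[leLHS](powRr0 k.+1%:R) ler_powR ?ler1n//.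
    by rewrite lee_fin in r1; exact: le_trans r1.
  have := h (Num.truncn B); rewrite leNgt => /negP; apply.
  have B0 : 0 <= B by apply: le_trans (h 0%N).
  by have /andP[] := truncn_itv B0.
rewrite lee_fin in r01.
have r00 : 0 < r0 by exact: lt_le_trans r01.
have inv1 k : (k.+1%:R)^-1 = k.+1%:R `^ (- 1) :> R by rewrite powR_inv1.
exists (fun k => k.+1%:R `^ (- r0^-1)); split=> [k|r r1|r r0r].
- by rewrite powR_gt0.
- case: r r1 => [r r1 rr0|//|//].
  rewrite lee_fin in r1; rewrite lee_fin in rr0.
  apply: (infinite_of_harmonic r 1) => // k.
  rewrite mul1r inv1 -powRrM ler_powR ?ler1n// mulNr lerN2.
  by rewrite mulrC ler_pdivrMr// mul1r.
- case: r r0r => [r r0r|_|//]; last first.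
    exists 1 => k; rewrite powRN invf_le1 ?powR_gt0//.
    by rewrite -[leLHS](powRr0 k.+1%:R) ler_powR ?ler1n// invr_ge0 ltW.
  rewrite lte_fin in r0r.
  have s1 : 1 < r0^-1 * r by rewrite mulrC ltr_pdivlMr// mul1r.
  apply/fin_seq_powR.
  rewrite (_ : (fun k => _) = (fun k => k.+1%:R `^ (- (r0^-1 * r)))).
    exact: power_finite.
  by apply/funext => k; rewrite -powRrM mulNr.
Qed.

(* The witness is the power [1 / r0] of the telescoping series of
   [1 / (1 + ln (k + 1))], and [1] if [r0 = +oo]. *)
Lemma threshold_open (r0 : \bar R) : (1 <= r0)%E -> exists b : nat -> R,
  [/\ forall k, 0 < b k,
      forall r, (1 <= r)%E -> (r < r0)%E -> ~ fin_seq r b &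
      forall r, (r0 <= r)%E -> fin_seq r b].
Proof.
case: r0 => [r0| |//] r01; last first.
  exists (fun=> 1); split=> [k//| |r]; last by case: r => // _; exists 1.
  case=> [r r1 _|//|//].
  apply: (infinite_of_harmonic r 1) => // k.
  by rewrite mul1r (_ : 1 `^ r = 1) ?invf_le1 ?ler1n// powR1.
rewrite lee_fin in r01.
have r00 : 0 < r0 by exact: lt_le_trans r01.
have r0V : 0 < r0^-1 by rewrite invr_gt0.
pose x k := lnseq k - lnseq k.+1.
have x0 k : 0 < x k := lnseq_diff_gt0 k.
have x1 k : x k <= 1 := lnseq_diff_le1 k.
exists (fun k => x k `^ r0^-1); split=> [k|r r1|r r0r].
- by rewrite powR_gt0.
- case: r r1 => [r r1 rr0|//|//].
  rewrite lee_fin in r1; rewrite lte_fin in rr0.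
  have th : 0 < r0^-1 * r < 1.
    apply/andP; split; first by rewrite mulr_gt0// (lt_le_trans ltr01).
    by rewrite mulrC ltr_pdivrMr// mul1r.
  have [C C0 h] := lnseq_infinite _ th.
  apply: (infinite_of_harmonic r C) => // k.
  by rewrite -powRrM; exact: h.
- case: r r0r => [r r0r|_|//]; last first.
    exists 1 => k; have E1 : 1 `^ r0^-1 = 1 :> R by rewrite powR1.
    rewrite -[leRHS]E1.
    by rewrite ge0_ler_powR ?nnegrE ?(ltW (x0 k))// ltW.
  rewrite lee_fin in r0r.
  have s1 : 1 <= r0^-1 * r by rewrite mulrC ler_pdivlMr// mul1r.
  have h1 : fin_seq 1%E x.
    apply: (fin_seq_telescope x lnseq 1) => // k; first exact: ltW.
      by rewrite /lnseq invr_ge0 ltW// lnseq_gt0.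
    by rewrite mul1r.
  (* Since [0 < x k <= 1] and [r / r0 >= 1], the power is at most [x k]. *)
  apply: le_lt_trans h1; apply: lee_nneseries => k _ => [_|].
    by rewrite lee_fin powR_ge0.
  rewrite lee_fin -powRrM powRr1 ?(ltW (x0 k))//.
  by apply: ge1r_powR => //; rewrite x0 x1.
Qed.

End series.

(** Reduces both parts of the theorem to finding a positive sequence [b] with the desired set of
    exponents [r] for which it lies in [l^r]. *)
Lemma maximal_space {R : realType} (p : R) (q : \bar R) (b : nat -> R) :
  1 <= p -> (1 <= q)%E -> (forall k, 0 < b k) ->
  exists (d : measure_display) (T : measurableType d)
         (rho : T -> T -> R) (mu : {measure set T -> \bar R}),
    [/\ metric_measure_space rho mu, ~ doubling rho mu,
        forall r : \bar R, (1 <= r)%E -> ~ fin_seq r b ->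
          cmax_const rho mu p q r = +oo%E &
        forall r : \bar R, (q <= r)%E -> fin_seq r b ->
          (cmax_const rho mu p q r < +oo)%E].
Proof.
move=> p1 q1 b0; have [N [D [m gr]]] := growth_exists p b p1 b0.
exists _, (vertex N), (@pdist N R), (space_measure N D m); split.
- exact: (space_metric_measure p b N D m p1 gr).
- exact: (space_not_doubling p b N D m p1 gr).
- by move=> r r1 nb; exact: (cmax_const_infty p b N D m p1 gr b0 q r q1 r1 nb).
- move=> r qr hb; have r1 : (1 <= r)%E by exact: le_trans qr.
  exact: (cmax_const_lty p b N D m p1 gr b0 q r q1 r1 qr hb).
Qed.

Theorem theorem4p2p1 (R : realType) (p0 : R) (q0 r0 : \bar R) :
  admissible p0 q0 r0 ->
  (exists (d : measure_display) (T : measurableType d)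
          (rho : T -> T -> R) (mu : {measure set T -> \bar R}),
     metric_measure_space rho mu /\ ~ doubling rho mu /\
     (forall r : \bar R, (q0 <= r)%E -> (r <= r0)%E ->
        cmax_const rho mu p0 q0 r = +oo%E) /\
     (forall r : \bar R, (r0 < r)%E ->
        (cmax_const rho mu p0 q0 r < +oo)%E)) /\
  (exists (d : measure_display) (T : measurableType d)
          (rho : T -> T -> R) (mu : {measure set T -> \bar R}),
     metric_measure_space rho mu /\ ~ doubling rho mu /\
     (forall r : \bar R, (q0 <= r)%E -> (r < r0)%E ->
        cmax_const rho mu p0 q0 r = +oo%E) /\
     (forall r : \bar R, (r0 <= r)%E ->
        (cmax_const rho mu p0 q0 r < +oo)%E)).
Proof.
move=> adm.
have [p1 q1 qr0] : [/\ 1 <= p0, (1 <= q0)%E & (q0 <= r0)%E].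
  case: adm => [[-> [-> ?]]|[/ltW ? [? ?]]]; by split.
have r1 : (1 <= r0)%E by exact: le_trans qr0.
split.
- have [b [b0 binf bfin]] := threshold_closed r0 r1.
  have [d [T [rho [mu [mms ndbl inf fin]]]]] := maximal_space p0 q0 b p1 q1 b0.
  exists d, T, rho, mu; split=> //; split=> //; split=> r.
  + move=> qr rr0; have r1' := le_trans q1 qr.
    by apply: inf => //; exact: binf.
  + by move=> r0r; apply: fin; [exact: le_trans qr0 (ltW r0r)|exact: bfin].
- have [b [b0 binf bfin]] := threshold_open r0 r1.
  have [d [T [rho [mu [mms ndbl inf fin]]]]] := maximal_space p0 q0 b p1 q1 b0.
  exists d, T, rho, mu; split=> //; split=> //; split=> r.
  + move=> qr rr0; have r1' := le_trans q1 qr.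
    by apply: inf => //; exact: binf.
  + by move=> r0r; apply: fin; [exact: le_trans qr0 r0r|exact: bfin].
Qed.
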